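(* Let $(S,\rho)$ be a separable compact metric space with a Borel measure $\nu$ such that $\nu(S)<\infty$ and $\nu$ has no atoms, i.e. $\nu(\{\zeta\})=0$ for all $\zeta\in S$. Let $(X,Y)$ be a random pair with values in $S^\infty\times\{0,\dots,M\}$ such that, for each $j=0,\dots,M$, $\mathbb P(Y=j)>0$ and, conditionally on $Y=j$, $X$ is a Poisson process on $S$ with intensity $\lambda_j:S\to[0,\infty)$, where each $\lambda_j$ is continuous (with respect to $\rho$). Then the Besicovitch condition holds for $\eta(x)=\mathbb E(Y\mid X=x)$ with respect to the Hausdorff distance $d_H$, that is, $$\lim_{\epsilon\to0}P_X\Big\{x:\lim_{\delta\to0}\frac1{P_X(B_{d_H}(x,\delta))}\int_{B_{d_H}(x,\delta)}|\eta(x)-\eta(y)|\,dP_X(y)>\epsilon\Big\}=0.$$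
   Context: $S^\infty=\{x\subset S:\#x<\infty\}$ is the set of finite subsets of $S$, equipped with the $\sigma$-algebra generated by the counting maps $x\mapsto\#(x\cap A)$, $A\subset S$ Borel; $P_X$ is the distribution of $X$ on $S^\infty$. A random element $Z$ of $S^\infty$ is a Poisson process on $S$ with ($\nu$-integrable) intensity $\lambda$ if, with $N_A=\#(Z\cap A)$: for disjoint Borel sets $A_1,\dots,A_n\subset S$ the variables $N_{A_1},\dots,N_{A_n}$ are independent, and $N_A$ is Poisson with mean $\mu(A)=\int_A\lambda\,d\nu$ for every Borel $A\subset S$. The Hausdorff distance is $d_H(A,C)=\max\{\sup_{a\in A}d(a,C),\sup_{c\in C}d(c,A)\}$ with $d(a,C)=\inf\{\rho(a,c):c\in C\}$; convention: $d_H(\emptyset,\emptyset)=0$, $d_H(\emptyset,x)=+\infty$ for $x\neq\emptyset$. $B_{d_H}(x,\delta)$ is the closed ball of centre $x$ and radius $\delta$ in $(S^\infty,d_H)$. *)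

(* Defs.v *)
From HB Require Import structures.
From mathcomp Require Import all_boot all_order all_algebra finmap.
From mathcomp Require Import all_classical all_reals all_analysis.

Set Implicit Arguments.
Unset Strict Implicit.
Unset Printing Implicit Defensive.
Import Order.TTheory GRing.Theory Num.Theory.
Import numFieldNormedType.Exports.
Local Open Scope classical_set_scope.
Local Open Scope ring_scope.

(* The library's measurable types are pointed, so a metric space carrying a
   Borel measure has to be inhabited. *)
#[short(type="pmetricType")]
HB.structure Definition PointedMetric (R : numDomainType) :=
  {M of Metric R M & isPointed M}.

Definition separable (T : topologicalType) : Prop :=
  exists D : set T, countable D /\ dense D.

Notation borel S := (g_sigma_algebraType (@open S)).

Section Configurations.
Context {R : realType} {S : pmetricType R}.

Definition npoints (A : set S) (x : {fset S}) : nat :=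
  #|` [fset z in x | z \in A]%fset |.

Definition counting_events : set (set {fset S}) :=
  [set npoints A @^-1` K | A in (measurable : set (set (borel S)))
                         & K in [set: set nat]].

Local Open Scope ereal_scope.

Definition dist_to (a : S) (C : {fset S}) : \bar R :=
  ereal_inf [set (mdist a c)%:E | c in [set` C]].

Definition hausdorff_dist (A C : {fset S}) : \bar R :=
  if A == fset0 then (if C == fset0 then 0 else +oo)
  else if C == fset0 then +oo
  else maxe (ereal_sup [set dist_to a C | a in [set` A]])
            (ereal_sup [set dist_to c A | c in [set` C]]).

End Configurations.
Arguments counting_events {R} S.

Notation config S := (g_sigma_algebraType (counting_events S)).

Section Probability.
Context {R : realType} {d} {T : measurableType d}.

Definition cond_prob (P : probability T R) (B : set T) : set T -> \bar R :=
  fun A => (P (A `&` B) * ((fine (P B))^-1)%:E)%E.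

(* Taking some of the B i to be the whole space gives the product rule for
   subfamilies. *)
Definition mutually_independent (P : set T -> \bar R) d' (U : measurableType d')
    (n : nat) (N : 'I_n -> T -> U) : Prop :=
  forall B : 'I_n -> set U, (forall i, measurable (B i)) ->
  P (\bigcap_(i : 'I_n) N i @^-1` B i) = (\prod_(i < n) P (N i @^-1` B i))%E.

(* [poisson_prob m] is the Poisson distribution of mean m (the Dirac mass at 0
   when m = 0); its second argument is unused in its definition. *)
Definition poisson_process (P : set T -> \bar R) (S : pmetricType R)
    (nu : {measure set (borel S) -> \bar R}) (lambda : S -> R)
    (Z : T -> config S) : Prop :=
  let N (A : set S) (t : T) := npoints A (Z t) in
  [/\ nu.-integrable [set: borel S] (fun z => (lambda z)%:E),
      (forall (n : nat) (A : 'I_n -> set (borel S)),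
         (forall i, measurable (A i)) -> trivIset [set: 'I_n] A ->
         mutually_independent P (fun i => N (A i))) &
      (forall A : set (borel S), measurable A ->
         forall K : set nat,
         P (N A @^-1` K) = poisson_prob (\int[nu]_(z in A) lambda z) 0 K)].

(* [eta] is a version of x |-> E(f | X = x). *)
Definition is_cond_expectation (P : probability T R) d' (U : measurableType d')
    (X : {RV P >-> U}) (f : T -> R) (eta : U -> R) : Prop :=
  (distribution P X).-integrable [set: U] (fun x => (eta x)%:E) /\
  forall A : set U, measurable A ->
  (\int[distribution P X]_(x in A) (eta x)%:E =
   \int[P]_(t in X @^-1` A) (f t)%:E)%E.

End Probability.

Section Besicovitch.
Context {R : realType} {d} {U : measurableType d}.
Variables (mu : {measure set U -> \bar R}) (dist : U -> U -> \bar R).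

Definition dist_ball (x : U) (delta : R) : set U :=
  [set y | (dist x y <= delta%:E)%E].

Definition ball_deviation (f : U -> R) (x : U) (delta : R) : R :=
  (fine (mu (dist_ball x delta)))^-1 *
  \int[mu]_(y in dist_ball x delta) `|f x - f y|.

(* [lim] returns a default value on divergent arguments: the first conjunct,
   implicit in the usual wording, excludes this for almost every x. *)
Definition besicovitch (f : U -> R) : Prop :=
  {ae mu, forall x, cvg (ball_deviation f x delta @[delta --> 0^'+])} /\
  mu [set x | lim (ball_deviation f x delta @[delta --> 0^'+]) > eps]
    @[eps --> 0^'+] --> 0%E.

End Besicovitch.

(* Main.v *)
Require Import Defs.
From HB Require Import structures.
From mathcomp Require Import all_boot all_order all_algebra finmap.
From mathcomp Require Import all_classical all_reals all_analysis.
From mathcomp Require Import measurable_realfun ring lra.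

Set Implicit Arguments.
Unset Strict Implicit.
Unset Printing Implicit Defensive.
Import Order.TTheory GRing.Theory Num.Theory.
Import numFieldNormedType.Exports.
Local Open Scope classical_set_scope.
Local Open Scope ring_scope.

(* Write Q_j for the restriction to {Y = j} of the law of X. The Laplace functional
   of a Poisson process shows that the densities F_j(x) = P(Y = j) e^{-mu_j(S)}
   prod_{z in x} lambda_j(z) satisfy F_i Q_j = F_j Q_i: both sides agree on the void
   events {x | N_A(x) = 0}, which form a pi-system generating the counting
   sigma-algebra. Hence eta has the version sum_j j F_j / sum_j F_j, defined
   P_X-almost everywhere. For small delta, the y in the ball B(x, delta) that do not
   have exactly one point near each point of x form a part of Q_j-measure at most
   (sum_{z in x} mu_j(B(z, delta))) Q_j(B(x, delta)), where the factor tends to 0 since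
   nu has no atoms; along the other y, F_j(y) tends to F_j(x) by continuity of
   lambda_j. So the deviation averages tend to 0 almost everywhere.

   Nothing is known about the measure of nonmeasurable sets, so the set where the
   limit exceeds epsilon has to be shown measurable: the averages are measurable in
   x by Fubini and, wherever the balls have positive measure, right-continuous in
   delta, so that their convergence can be tested on rational radii. *)

(** * Measures given by a density, and integration against them *)

Section Density.
Context d (T : measurableType d) (R : realType).
Import HBNNSimple.
Local Open Scope ereal_scope.

(** Additivity is monotone convergence; the change of density passes from indicators to simple
    functions by linearity and to [g] by monotone limits. It serves both for the mean measures over
    [nu] and for weighting the laws on configurations. *)
Lemma density_measure (mu : {measure set T -> \bar R}) (f : T -> R) :
  measurable_fun setT f -> (forall x, (0 <= f x)%R) ->
  exists m : {measure set T -> \bar R},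
    (forall A, measurable A -> m A = \int[mu]_(x in A) (f x)%:E) /\
    (forall g : T -> \bar R, measurable_fun setT g -> (forall x, 0 <= g x) ->
      forall D, measurable D ->
        \int[m]_(x in D) g x = \int[mu]_(x in D) (g x * (f x)%:E)).
Proof.
move=> mf f0.
have f0' x : 0 <= (f x)%:E by rewrite lee_fin.
have mfE D : measurable_fun D (fun x => (f x)%:E).
  by apply: measurable_funTS; exact/measurable_EFinP.
pose m0 (A : set T) := \int[mu]_(x in A) (f x)%:E.
have m00 : m0 set0 = 0 by rewrite /m0 integral_set0.
have m0ge A : 0 <= m0 A by exact: integral_ge0.
have m0sig : semi_sigma_additive m0.
  move=> F mF tF mUF; rewrite /m0.
  apply: cvg_toP.
    by apply: is_cvg_nneseries => n _ _; exact: m0ge.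
  by rewrite ge0_integral_bigcup.
pose m : {measure set T -> \bar R} :=
  HB.pack m0 (isMeasure.Build d T R m0 m00 m0ge m0sig).
exists m; split=> // g mg g0 D mD.
pose h := nnsfun_approx mD (measurable_funTS mg : measurable_fun D g).
have -> : \int[m]_(x in D) g x =
    limn (fun n => \int[m]_(x in D) (h n x)%:E).
  rewrite -monotone_convergence//.
  - apply: eq_integral => x /[!inE] xD; apply/esym/cvg_lim => //.
    by apply: cvg_nnsfun_approx.
  - by move=> n; apply/measurable_EFinP; exact: measurable_funTS.
  - by move=> n x _; rewrite lee_fin.
  - by move=> x _ a b ab; rewrite lee_fin; exact/lefP/nd_nnsfun_approx.
have -> : \int[mu]_(x in D) (g x * (f x)%:E) =
    limn (fun n => \int[mu]_(x in D) ((h n x)%:E * (f x)%:E)).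
  rewrite -monotone_convergence//.
  - apply: eq_integral => x /[!inE] xD; apply/esym/cvg_lim => //.
    by apply: cvgeZr => //; apply: cvg_nnsfun_approx.
  - move=> n; apply: emeasurable_funM => //.
    by apply/measurable_EFinP; exact: measurable_funTS.
  - by move=> n x _; rewrite mule_ge0// lee_fin.
  - move=> x _ a b ab; rewrite lee_wpmul2r// lee_fin.
    exact/lefP/nd_nnsfun_approx.
congr (limn _); apply/funext => n.
(* Splitting [h n] along its values leaves indicators of level sets, for which the identity is the
   definition of [m]. *)
transitivity (\int[m]_(x in D)
   (\sum_(y \in range (h n)) (y * \1_(h n @^-1` [set y]) x)%:E)).
  by apply: eq_integral => t tE; rewrite /= fimfunE -fsumEFin.
have indich r : measurable_fun D (fun x => (r * \1_(h n @^-1` [set r]) x)%:E).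
  by apply: (measurable_comp measurableT) => //; exact: measurable_funM.
rewrite ge0_integral_fsum//; last by move=> y x _; exact: nnfun_muleindic_ge0.
transitivity (\int[mu]_(x in D) (\sum_(y \in range (h n))
    (y * \1_(h n @^-1` [set y]) x)%:E * (f x)%:E)); last first.
  apply: eq_integral => x xE.
  rewrite -ge0_mule_fsuml => [|y]; last exact: nnfun_muleindic_ge0.
  by rewrite fsumEFin // -(fimfunE _ x).
rewrite ge0_integral_fsum//; last 2 first.
  - by move=> y; apply: emeasurable_funM.
  - by move=> y x _; rewrite mule_ge0// nnfun_muleindic_ge0.
apply: eq_fsbigr => r /set_mem rhn.
have r0 : (0 <= r)%R by move: rhn => -[t _ <-].
under eq_integral do rewrite EFinM.
rewrite integralZl_indic_nnsfun//.
under [RHS]eq_integral do rewrite EFinM -muleA.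
rewrite ge0_integralZl//.
- congr (_ * _).
  rewrite integral_indic//= /m0 setIC integral_mkcondr epatch_indic.
  by apply: eq_integral => x _ /=; rewrite muleC.
- apply: emeasurable_funM => //; exact/measurable_EFinP.
- by move=> x _; rewrite mule_ge0// lee_fin.
Qed.
End Density.

(** * Expectation of a product of functions of independent counts *)

Section ProductExpectation.
Context d (T : measurableType d) (R : realType).
Variables (Q : {measure set T -> \bar R}) (N : nat -> T -> nat).
Variables (q g : nat -> nat -> R) (s : nat -> R).
Hypothesis mN : forall i, measurable_fun setT (N i).
Hypothesis q0 : forall i k, 0 <= q i k.
Hypothesis g0 : forall i k, 0 <= g i k.
Local Open Scope ereal_scope.
Hypothesis qg_sum : forall i, \sum_(k <oo) (g i k * q i k)%:E = (s i)%:E.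

(** Induction on [n], cutting [D] along the value [k] of the last count: there the last factor is
    constant and the induction hypothesis applies with mass [p * q n k]. This is why [D] and [p] are
    kept general; summing over [k] produces [s n]. *)
Lemma integral_prod_nat_rv n (D : set T) (p : R) : measurable D -> (0 <= p)%R ->
  (forall k : nat -> nat,
    Q (D `&` [set x | forall i, (i < n)%N -> N i x = k i]) =
    (p * \prod_(i < n) q i (k i))%:E) ->
  \int[Q]_(x in D) (\prod_(i < n) g i (N i x))%:E =
  (p * \prod_(i < n) s i)%:E.
Proof.
have mg i : measurable_fun setT (fun x => g i (N i x)).
  exact: (measurableT_comp (f := g i)).
have s0 i : (0 <= s i)%R.
  rewrite -lee_fin -qg_sum.
  by apply: nneseries_ge0 => k _ _; rewrite lee_fin mulr_ge0.
elim: n D p => [|n IH] D p mD p0 Hlaw.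
  under eq_integral do rewrite big_ord0.
  rewrite integral_cst// mul1e big_ord0 mulr1.
  have := Hlaw (fun=> 0%N); rewrite big_ord0 mulr1 => <-.
  by congr (Q _); apply/seteqP; split => [x Dx|x []//].
pose Dk k := D `&` N n @^-1` [set k].
have mDk k : measurable (Dk k).
  by apply: measurableI => //; rewrite -[X in measurable X]setTI; exact: mN.
have DE : D = \bigcup_k Dk k.
  by apply/seteqP; split => [x Dx|x [k _ []]//]; exists (N n x).
have mP m : measurable_fun setT (fun x => (\prod_(i < m) g i (N i x))%:E).
  by apply/measurable_EFinP; apply: measurable_prod => i _; exact: mg.
rewrite [in LHS]DE ge0_integral_bigcup//; last 3 first.
- by apply: measurable_funTS; exact: mP.
- by move=> x _; rewrite lee_fin prodr_ge0.
- by move=> i j _ _ [x [[_ /= <-] [_ /= <-]]].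
rewrite big_ord_recr/= mulrA.
have IHk k : \int[Q]_(x in Dk k) (\prod_(i < n.+1) g i (N i x))%:E =
    (p * \prod_(i < n) s i)%:E * (g n k * q n k)%:E.
  transitivity (\int[Q]_(x in Dk k) ((g n k)%:E * (\prod_(i < n) g i (N i x))%:E)).
    apply: eq_integral => x /set_mem[_ /= <-].
    by rewrite big_ord_recr/= -EFinM mulrC.
  rewrite ge0_integralZl//; last 3 first.
  - by apply: measurable_funTS; exact: mP.
  - by move=> x _; rewrite lee_fin prodr_ge0.
  - by rewrite lee_fin.
  rewrite (IH _ (p * q n k)%R)//; last 2 first.
  - by rewrite mulr_ge0.
  - move=> kk.
    (* The prescribed values [kk] below [n] are extended by the value [k] at index [n], to use the
       joint law of [n.+1] counts. *)
    pose k' i := if i == n then k else kk i.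
    transitivity (Q (D `&` [set x | forall i, (i < n.+1)%N -> N i x = k' i])).
      congr (Q _); apply/seteqP; split => [x [[Dx /= Nk] H]|x [Dx /= H]].
        split=> // i; rewrite ltnS leq_eqVlt /k' => /predU1P[->|ltin].
          by rewrite eqxx.
        by rewrite (ltn_eqF ltin) H.
      split; first by split => //=; rewrite H// /k' eqxx.
      by move=> i ltin; rewrite H 1?ltnW// /k' (ltn_eqF ltin).
    rewrite Hlaw big_ord_recr/= {2}/k' eqxx; congr (_%:E).
    under eq_bigr => i _ do rewrite /k' (ltn_eqF (ltn_ord i)).
    by rewrite mulrA mulrAC.
  rewrite -!EFinM; congr (_%:E); ring.
under eq_eseriesr do rewrite IHk.
rewrite nneseriesZl//; last by move=> k _; rewrite lee_fin mulr_ge0.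
by rewrite qg_sum.
Qed.
End ProductExpectation.

(** * Point masses and generating function of the Poisson distribution *)

Section PoissonSeries.
Context {R : realType}.
Implicit Types m r : R.
Local Open Scope ereal_scope.

(** At [m = 0] the distribution is a Dirac mass, and the formula still holds because
    [0 ^+ 0 = 1]. *)
Lemma poisson_prob_set1 m k : (0 <= m)%R ->
  poisson_prob m 0 [set k] = (m ^+ k / k`!%:R * expR (- m))%:E.
Proof.
rewrite /poisson_prob; case: ifPn => [m0 _|].
  by rewrite esum_set1 ?lee_fin ?poisson_pmf_ge0// /poisson_pmf m0.
rewrite -leNgt => m0 m0'; have -> : m = 0%R by apply/eqP; rewrite eq_le m0.
rewrite diracE oppr0 expR0 mulr1; case: k => [|k].
  by rewrite expr0 fact0 invr1 mulr1 mem_set.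
by rewrite exprS !mul0r memNset.
Qed.

(** The exponential series at [r * m], times [expR (- m)]: this is the mean of [r ^+ N] for a
    Poisson variable [N]. *)
Lemma nneseries_poisson_generating m r : (0 <= m)%R -> (0 <= r)%R ->
  \sum_(k <oo) (r ^+ k * (m ^+ k / k`!%:R * expR (- m)))%:E =
  (expR (r * m - m))%:E.
Proof.
move=> m0 r0.
have E (k : nat) : (r ^+ k * (m ^+ k / k`!%:R * expR (- m)))%:E =
    (expR (- m))%:E * ((r * m) ^+ k / k`!%:R)%:E.
  rewrite exprMn -EFinM; congr (_%:E).
  by move: (k`!%:R^-1)%R (expR (- m)) => t u; ring.
under eq_eseriesr do rewrite E.
rewrite nneseriesZl; last first.
  by move=> k _; rewrite lee_fin divr_ge0// exprn_ge0// mulr_ge0.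
rewrite addrC expRD EFinM; congr (_ * _).
rewrite expRE -EFin_lim; last first.
  rewrite /pseries/=; under eq_fun do rewrite mulrC.
  exact: is_cvg_series_exp_coeff.
apply/congr_lim/funext => n/=; rewrite /pseries/= /series/= -sumEFin//.
by under eq_bigr do rewrite mulrC.
Qed.

Lemma poisson_prob_gt0 m : (0 <= m)%R ->
  poisson_prob m 0 [set k | (0 < k)%N] = (1 - expR (- m))%:E.
Proof.
move=> m0; have -> : [set k | (0 < k)%N] = ~` [set 0%N].
  by apply/seteqP; split => -[|k] //=.
rewrite (probability_setC (poisson_prob m 0))//.
by rewrite [X in _ - X]poisson_prob_set1// expr0 fact0 invr1 !mul1r.
Qed.
End PoissonSeries.

(** The inverse agrees with the real power of exponent -1, also at zero, where both take the value
    0. *)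
Lemma measurable_funV_ge0 d (T : measurableType d) (R : realType) (f : T -> R) :
  (forall x, 0 <= f x) -> measurable_fun [set: T] f ->
  measurable_fun [set: T] (fun x => (f x)^-1).
Proof.
move=> f0 mf; apply: (eq_measurable_fun (fun x => f x `^ (-1))).
  by move=> x _; rewrite powR_inv1.
exact: (measurableT_comp (measurable_powR _)).
Qed.

Lemma near_right0P (R : realType) (P : R -> Prop) :
  (\forall r \near 0^'+, P r) <->
  exists n : nat, forall r, 0 < r -> r < n.+1%:R^-1 -> P r.
Proof.
split=> [[e /= e0 He]|[n Hn]].
  have [n _ Hn] := near_infty_natSinv_lt (PosNum e0).
  exists n => r r0 rn; apply: He => //=.
  rewrite sub0r normrN gtr0_norm// (lt_trans rn)//.
  exact: (Hn n (leqnn n)).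
near=> r; apply: Hn => //; near: r; exact: nbhs_right_lt.
Unshelve. all: by end_near. Qed.

(** * Measurability of the ball averages and of their limit *)

Section BallDeviation.
Context d (U : measurableType d) (R : realType).
Variables (mu : {finite_measure set U -> \bar R}) (dist : U -> U -> \bar R).
Hypothesis measurable_dist_le : forall r : R, 0 < r ->
  measurable [set xy : U * U | (dist xy.1 xy.2 <= r%:E)%E].
Variable f : U -> R.
Hypothesis f_int : mu.-integrable [set: U] (EFin \o f).

Let mf : measurable_fun [set: U] f.
Proof. by apply/measurable_EFinP; exact: measurable_int f_int. Qed.

Let ball_xsection r x : dist_ball dist x r =
  xsection [set xy : U * U | (dist xy.1 xy.2 <= r%:E)%E] x.
Proof. by apply/seteqP; split=> y; rewrite /xsection/= inE. Qed.

Lemma measurable_dist_ball (r : R) x : 0 < r -> measurable (dist_ball dist x r).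
Proof.
by move=> r0; rewrite ball_xsection; apply: measurable_xsection; exact: measurable_dist_le.
Qed.

Lemma integrable_deviation x :
  mu.-integrable [set: U] (fun y => `|f x - f y|%:E).
Proof.
apply: (@integrable_abse _ _ _ mu setT (fun y => (f x - f y)%:E)).
under eq_fun do rewrite EFinB.
by apply: integrableB => //; exact: finite_measure_integrable_cst.
Qed.

(** Balls are sections of a measurable subset of the product, so Fubini and Tonelli make both the
    mass of the ball and the integral over it measurable in the centre. *)
Lemma measurable_ball_deviation (r : R) : 0 < r ->
  measurable_fun [set: U] (ball_deviation mu dist f ^~ r).
Proof.
move=> r0; have mB := measurable_dist_le r0.
set B := [set xy | _] in mB.
apply: measurable_funM.
  apply: measurable_funV_ge0; first by move=> x; exact: fine_ge0.
  apply: measurableT_comp => //.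
  apply: eq_measurable_fun (measurable_fun_xsection mu mB) => x _ /=.
  by rewrite ball_xsection.
rewrite /Rintegral; apply: measurableT_comp => //.
pose h (xy : U * U) : \bar R := (`|f xy.1 - f xy.2| * \1_B xy)%:E.
have mh : measurable_fun setT h.
  apply/measurable_EFinP; apply: measurable_funM; last exact: measurable_indic.
  apply: measurableT_comp => //; apply: measurable_funB.
    exact: measurableT_comp measurable_fst.
  exact: measurableT_comp measurable_snd.
have h0 xy : (0 <= h xy)%E by rewrite lee_fin mulr_ge0.
apply: eq_measurable_fun (measurable_fun_fubini_tonelli_F (m2 := mu) h mh h0) => x _.
transitivity (\int[mu]_y ((fun y => `|f x - f y|%:E) \_ (dist_ball dist x r)) y)%E.
  apply: eq_integral => y _; rewrite epatch_indic /h/= EFinM.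
  by rewrite !indicE ball_xsection mem_xsection.
by rewrite -integral_mkcond.
Qed.

(** A closed ball is the limit of the larger balls about the same centre, since a point outside it
    is eventually outside them; dominated convergence with bound [|h|] does the rest. *)
Lemma cvg_integral_dist_ball (h : U -> R) x (r : R) (q : nat -> R) :
  0 < r -> mu.-integrable [set: U] (EFin \o h) ->
  (forall n, r < q n) -> q @ \oo --> r ->
  (\int[mu]_(y in dist_ball dist x (q n)) h y @[n --> \oo] -->
   \int[mu]_(y in dist_ball dist x r) h y).
Proof.
move=> r0 ih rq qr; have mh := measurable_int _ ih.
have q0 n : 0 < q n by rewrite (lt_trans r0).
have mBr := measurable_dist_ball x r0.
have mBq n := measurable_dist_ball x (q0 n).
have iq : mu.-integrable (dist_ball dist x r) (EFin \o h).
  exact: integrableS ih.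
apply: fine_cvg; rewrite fineK; last exact: integrable_fin_num.
rewrite integral_mkcond; under eq_fun do rewrite integral_mkcond.
have [|||||_ _] // := @dominated_convergence _ _ _ mu setT measurableT
  (fun n => (EFin \o h) \_ (dist_ball dist x (q n)))
  ((EFin \o h) \_ (dist_ball dist x r)) (fun y => `|(h y)%:E|%E).
- move=> n; apply/(measurable_restrictT _ (mBq n)); exact: measurable_funTS.
- apply/(measurable_restrictT _ mBr); exact: measurable_funTS.
- apply: aeW => y _; apply: cvg_near_cst.
  have [yr|ry] := leP (dist x y) r%:E.
    near=> n; rewrite !patchE !mem_set//.
    by rewrite /dist_ball/= (le_trans yr)// lee_fin ltW.
  have : \forall n \near \oo, ((q n)%:E < dist x y)%E.
    move: ry; case: (dist x y) => [t| |]//= rt; last first.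
      by near=> n; rewrite ltry.
    by near do rewrite lte_fin; rewrite lte_fin in rt; exact: cvgr_lt qr _ rt.
  apply: filterS => n qn; rewrite !patchE !memNset//; rewrite /dist_ball/=.
    by apply/negP; rewrite -ltNge.
  by apply/negP; rewrite -ltNge.
- exact: integrable_abse.
- apply: aeW => y n _; rewrite patchE; case: ifPn => // _.
  by rewrite abse0.
Unshelve. all: by end_near. Qed.

Lemma fine_measure_Rintegral A : measurable A -> fine (mu A) = \int[mu]_(y in A) 1.
Proof. by move=> mA; rewrite /Rintegral integral_cst// mul1e. Qed.

(** Rational radii suffice for testing convergence at [0^'+]; the bound [s] keeps the rational
    radius inside the neighbourhood under consideration. *)
Lemma ball_deviation_rat x (r s e : R) : 0 < r -> r < s -> 0 < e ->
  exists q : rat, [/\ 0 < ratr q :> R, ratr q < s &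
    `|ball_deviation mu dist f x r - ball_deviation mu dist f x (ratr q)| < e].
Proof.
(* If the ball is null, so is any smaller ball of rational radius, and both averages are 0 because
   [0^-1 = 0]. Otherwise the average is right-continuous at [r], the inverse being continuous at a
   nonzero mass. *)
move=> r0 rs e0; have [m0|mN0] := eqVneq (fine (mu (dist_ball dist x r))) 0.
  have [q] := rat_in_itvoo r0; rewrite in_itv/= => /andP[q0 qr].
  exists q; split=> //; first exact: lt_trans rs.
  have m0' : fine (mu (dist_ball dist x (ratr q))) = 0.
    apply/eqP; rewrite eq_le fine_ge0// andbT -m0.
    apply: fine_le.
    - by apply: fin_num_measure; exact: measurable_dist_ball.
    - by apply: fin_num_measure; exact: measurable_dist_ball.
    - apply: le_measure; rewrite ?inE; try exact: measurable_dist_ball.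
      by move=> y; rewrite /dist_ball/= => /le_trans; apply; rewrite lee_fin ltW.
  by rewrite /ball_deviation m0 m0' invr0 !mul0r subrr normr0.
have /choice[q qP] : forall n : nat, exists q : rat,
    r < ratr q /\ ratr q < r + n.+1%:R^-1.
  move=> n; have : r < r + n.+1%:R^-1 by rewrite ltrDl invr_gt0.
  by move=> /rat_in_itvoo[q]; rewrite in_itv/= => /andP[? ?]; exists q.
have qr : (ratr (q n) : R) @[n --> \oo] --> r.
  apply: (@squeeze_cvgr _ _ _ _ (cst r) (fun n => r + n.+1%:R^-1)).
  - by near=> n; have [/ltW -> /ltW ->] := qP n.
  - exact: cvg_cst.
  - by rewrite -[X in _ --> X]addr0; apply: cvgD; [exact: cvg_cst|exact: cvg_harmonic].
have rq n : r < ratr (q n) by case: (qP n).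
have cvgI h := @cvg_integral_dist_ball h x r (ratr \o q) r0 ^~ rq.
have cdev : ball_deviation mu dist f x (ratr (q n)) @[n --> \oo] -->
    ball_deviation mu dist f x r.
  apply: cvgM; last by apply: cvgI => //; exact: integrable_deviation.
  apply: cvgV => //.
  rewrite fine_measure_Rintegral; last exact: measurable_dist_ball.
  under eq_fun.
    move=> n; rewrite fine_measure_Rintegral; last first.
      by apply: measurable_dist_ball; rewrite (lt_trans r0).
    over.
  by apply: cvgI => //; exact: finite_measure_integrable_cst.
have [n [qs dn]] : exists n, ratr (q n) < s /\
  `|ball_deviation mu dist f x r - ball_deviation mu dist f x (ratr (q n))| < e.
  have : \forall n \near \oo, ratr (q n) < s /\
  `|ball_deviation mu dist f x r - ball_deviation mu dist f x (ratr (q n))| < e.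
    near=> n; split; near: n; first exact: cvgr_lt qr _ rs.
    exact: cvgr_dist_lt.
  by move=> /filter_ex.
by exists (q n); split=> //; rewrite (lt_trans r0).
Unshelve. all: by end_near. Qed.

Let near0 (n : nat) (q : rat) : bool :=
  (0 < ratr q :> R) && (ratr q < n.+1%:R^-1 :> R).

(** The Cauchy criterion at [0^'+] tested on rational radii, hence built by countably many
    operations. *)
Let rat_cauchy : set U := \bigcap_(k : nat) \bigcup_(n : nat)
  ~` (\bigcup_(q : rat) \bigcup_(r : rat)
    [set x | [/\ near0 n q, near0 n r &
      k.+1%:R^-1 < `|ball_deviation mu dist f x (ratr q) -
                     ball_deviation mu dist f x (ratr r)| ]]).

Let measurable_rat_cauchy : measurable rat_cauchy.
Proof.
apply: bigcapT_measurable => k; apply: bigcupT_measurable => n.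
apply: measurableC; apply: bigcupT_measurable_rat => q.
apply: bigcupT_measurable_rat => r.
have [qb|/negP qb] := boolP (near0 n q); last first.
  rewrite [X in measurable X](_ : _ = set0)//.
  by apply/seteqP; split => x [].
have [rb|/negP rb] := boolP (near0 n r); last first.
  rewrite [X in measurable X](_ : _ = set0)//.
  by apply/seteqP; split => x [].
case/andP: (qb) => q0 _; case/andP: (rb) => r0 _.
have mqr : measurable_fun [set: U] (fun x =>
    `|ball_deviation mu dist f x (ratr q) - ball_deviation mu dist f x (ratr r)|).
  apply: measurableT_comp => //.
  by apply: measurable_funB; exact: measurable_ball_deviation.
have := mqr measurableT _ (measurable_itv `]k.+1%:R^-1, +oo[).
congr (measurable _); apply/seteqP; split => x /=; rewrite in_itv/= andbT.
  by case.
by case.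
Qed.

Let rat_cauchyE :
  [set x | cvg (ball_deviation mu dist f x r @[r --> 0^'+])] = rat_cauchy.
Proof.
apply/seteqP; split => x /=.
  move=> /cvg_ex[l xl] k _.
  have k0 : 0 < k.+1%:R^-1 / 2 :> R by rewrite divr_gt0.
  move/cvgrPdist_lt : xl => /(_ _ k0)/near_right0P[n Hn].
  exists n => // -[q _ [r _ [/andP[q0 qn] /andP[r0 rn]]]].
  apply/negP; rewrite -leNgt ltW// (splitr k.+1%:R^-1).
  rewrite (le_lt_trans (ler_distD l _ _))// ltrD//; last exact: Hn.
  by rewrite distrC; exact: Hn.
move=> cx; apply/cauchy_cvgP/cauchyP => e e0.
have e20 : 0 < e / 2 by rewrite divr_gt0.
have [k _ /(_ k (leqnn _))/= ke] := near_infty_natSinv_lt (PosNum e20).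
have [n _ Hn] := cx k I.
(* The average at one fixed rational radius serves as the centre required by the Cauchy criterion;
   every other radius is compared with it through a rational neighbour. *)
have /rat_in_itvoo[q0] : (0 : R) < n.+1%:R^-1 by [].
rewrite in_itv/= => q0n.
exists (ball_deviation mu dist f x (ratr q0)).
apply/near_right0P; exists n => r r0 rn.
have [q [q_gt0 qn rq]] := ball_deviation_rat x r0 rn e20.
rewrite /ball/= distrC (splitr e).
rewrite (le_lt_trans (ler_distD (ball_deviation mu dist f x (ratr q)) _ _))//.
rewrite ltrD// (le_lt_trans _ ke)// leNgt; apply/negP => kq.
by apply: Hn; exists q => //; exists q0 => //; split=> //; rewrite /near0 q_gt0.
Qed.

(** On the set of convergence the limit is the upper limit along the radii [n.+1%:R^-1], which is
    measurable; off that set [lim] is the constant [point]. *)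
Lemma measurable_lim_ball_deviation (e : R) :
  measurable [set x | lim (ball_deviation mu dist f x r @[r --> 0^'+]) > e].
Proof.
pose L x := limn_esup (fun n => (ball_deviation mu dist f x n.+1%:R^-1)%:E).
have mL : measurable_fun setT L.
  apply: measurable_fun_limn_esup => n; apply/measurable_EFinP.
  exact: measurable_ball_deviation.
rewrite [X in measurable X](_ : _ = (rat_cauchy `&` [set x | (e%:E < L x)%E]) `|`
   (~` rat_cauchy `&` [set x | e < (point : R)])).
  apply: measurableU; apply: measurableI => //.
  - by rewrite -[X in measurable X]setTI; exact: emeasurable_fun_o_infty.
  - exact: measurableC.
  - have [h|/negP h] := boolP (e < (point : R)).
      by rewrite [X in measurable X](_ : _ = setT)//; apply/seteqP; split.
    by rewrite [X in measurable X](_ : _ = set0)//; apply/seteqP; split.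
have seq0 : n.+1%:R^-1 @[n --> \oo] --> (0 : R)^'+.
  move=> A /near_right0P[n Hn]; exists n.+1 => // m /= nm.
  by apply: Hn => //; rewrite ltf_pV2 ?posrE// ltr_nat.
have LE x : rat_cauchy x ->
    L x = (lim (ball_deviation mu dist f x r @[r --> 0^'+]))%:E.
  rewrite -rat_cauchyE => /= /cvg_ex[l xl]; rewrite (cvg_lim _ xl)//.
  apply: (cvg_limn_einf_sup _).2.
  by apply: cvg_EFin; [exact: nearW|exact: cvg_comp seq0 xl].
apply/seteqP; split => x /=.
  have [cx|dx] := pselect (rat_cauchy x).
    by move=> ex; left; split=> //; rewrite LE.
  move=> ex; right; split=> //; move: dx ex; rewrite -rat_cauchyE /=.
  by move/dvgP => ->.
case=> -[cx]; first by rewrite LE.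
by move: cx; rewrite -rat_cauchyE /= => /dvgP ->.
Qed.

(** For every [e > 0] the exceptional set is measurable and lies in a null set, so its measure is 0
    and the outer limit is that of a constant. *)
Lemma besicovitch_ae :
  {ae mu, forall x, ball_deviation mu dist f x r @[r --> 0^'+] --> 0} ->
  besicovitch mu dist f.
Proof.
move=> H; split.
  by apply: filterS H => x Hx; apply/cvg_ex; exists 0.
apply: cvg_near_cst.
near=> e; have e0 : 0 < e by [].
apply/eqP; rewrite eq_le measure_ge0 andbT.
case: H => N [mN N0 HN].
rewrite -N0; apply: le_measure; rewrite ?inE//.
  exact: measurable_lim_ball_deviation.
apply: subset_trans HN => x /= + Hx.
by rewrite (cvg_lim _ Hx)// ltNge (ltW e0).
Unshelve. all: by end_near. Qed.

End BallDeviation.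

(** * Balls, dense sequences and finite sets in a metric space *)

Section MetricFacts.
Context {R : realType} {S : pmetricType R}.
Implicit Types (z : S) (r e : R).

Lemma mball_open z r : open [set y : S | mdist z y < r].
Proof.
rewrite openE => y /= zy; apply/nbhs_ballP; exists (r - mdist z y) => /=.
  by rewrite subr_gt0.
rewrite ballEmdist => t /= yt; rewrite (le_lt_trans (metric_triangle z y t))//.
by rewrite -ltrBrDl.
Qed.

Lemma measurable_mball z r : measurable ([set y | mdist z y < r] : set (borel S)).
Proof.
by apply: sub_sigma_algebra; exact: mball_open.
Qed.

Lemma measurable_mcball z r : measurable ([set y | mdist z y <= r] : set (borel S)).
Proof.
rewrite [X in measurable X](_ : _ =
    \bigcap_n [set y | mdist z y < r + n.+1%:R^-1]).
  by apply: bigcapT_measurable => n; exact: measurable_mball.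
apply/seteqP; split=> [y /= zy n _|y /= zy].
  by rewrite /= (le_lt_trans zy)// ltrDl invr_gt0.
apply/ler_addgt0Pr => e e0.
have [n _ /(_ n (leqnn n))/= ne] := near_infty_natSinv_lt (PosNum e0).
by rewrite ltW// (lt_trans (zy n I))// ltrD2l.
Qed.

Lemma separable_seq : separable S ->
  exists q : nat -> S, forall z e, 0 < e -> exists n, mdist (q n) z < e.
Proof.
move=> [D [/countable_injP[f finj] dD]].
(* Indices outside the image of the injection [f] receive the default point, which does not affect
   density. *)
pose q n := xget (point : S) [set z | D z /\ f z = n].
exists q => z e e0.
have [y [zy Dy]] : [set y | mdist z y < e] `&` D !=set0.
  apply: dD; last exact: mball_open.
  by exists z; rewrite /= mdistxx.
exists (f y); have -> : q (f y) = y.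
  rewrite /q; case: xgetP => [t -> [Dt ft]|/(_ y)]; last by case.
  by apply: finj; rewrite ?inE.
by rewrite metric_sym.
Qed.

(** A minimum over finitely many distances: strict inequalities leave room [e], which approximation
    by a dense sequence can then consume. *)
Lemma finite_dist_gap (z : S) (s : seq S) r :
  (forall y, y \in s -> r < mdist z y) ->
  exists2 e : R, 0 < e & forall y, y \in s -> r + e < mdist z y.
Proof.
elim: s => [_|y s IH H]; first by exists 1.
have [|e e0 He] := IH; first by move=> t ts; apply: H; rewrite inE ts orbT.
have ry : r < mdist z y by apply: H; rewrite inE eqxx.
exists (Num.min e ((mdist z y - r) / 2)) => [|t].
  by rewrite lt_min e0 divr_gt0// subr_gt0.
rewrite inE => /predU1P[->|/He].
  have : Num.min e ((mdist z y - r) / 2) <= (mdist z y - r) / 2.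
    by rewrite ge_min lexx orbT.
  lra.
apply: le_lt_trans; rewrite lerD2l ge_min lexx//.
Qed.

End MetricFacts.

(** * The counting sigma-algebra and its generation by void events *)

Section CountingVariables.
Context {R : realType} {S : pmetricType R}.
Implicit Types (A B : set (borel S)) (x y : {fset S}).

Lemma npointsE A x : npoints A x = (\sum_(z <- x) (z \in A : nat))%N.
Proof.
rewrite /npoints card_fset_sum1 big_fset/= big_mkcond/=.
by apply: eq_bigr => z _; case: (z \in A).
Qed.

Lemma npoints0P A x : npoints A x = 0%N <-> forall z, z \in x -> ~ A z.
Proof.
rewrite /npoints; split=> [/cardfs0_eq x0 z zx Az|H].
  have : z \in [fset z in x | z \in A]%fset by rewrite !inE zx mem_set.
  by rewrite x0 inE.
apply/eqP; rewrite cardfs_eq0; apply/eqP/fsetP => z; rewrite !inE.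
by apply/negP => /andP[zx]; rewrite inE; exact: H.
Qed.

Lemma npoints_gt0P A x : (0 < npoints A x)%N <-> exists2 z, z \in x & A z.
Proof.
rewrite lt0n; split=> [/eqP x0|[z zx Az]].
  apply: contrapT => H; apply: x0; apply/npoints0P => z zx Az.
  by apply: H; exists z.
by apply/eqP => /npoints0P/(_ z zx).
Qed.

Lemma npoints_setID A B x :
  npoints A x = (npoints (A `&` B) x + npoints (A `\` B) x)%N.
Proof.
rewrite !npointsE -big_split/=; apply: eq_bigr => z _.
by rewrite in_setI in_setD; case: (z \in A); case: (z \in B).
Qed.

Lemma measurable_npoints A : measurable A ->
  measurable_fun [set: config S] (npoints A : config S -> nat).
Proof.
move=> mA _ K _; rewrite setTI; apply: sub_sigma_algebra.
by exists A => //; exists K.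
Qed.

Definition void_events : set (set (config S)) :=
  [set [set x | npoints A x = 0%N] | A in (measurable : set (set (borel S)))].

Lemma setI_closed_void_events : setI_closed void_events.
Proof.
move=> _ _ [A mA <-] [B mB <-]; exists (A `|` B); first exact: measurableU.
apply/seteqP; split=> x /=.
  move/npoints0P => H; split; apply/npoints0P => z zx Az; apply: (H z zx).
    by left.
  by right.
move=> [/npoints0P HA /npoints0P HB]; apply/npoints0P => z zx [].
  exact: HA.
exact: HB.
Qed.

(* A finite set has at least k+1 points in A iff some ball of a countable base
   meets it in A while k points of A remain outside: so the counting events
   are obtained from the void events by countably many operations. *)
Lemma counting_events_void : separable S ->
  (measurable : set (set (config S))) = <<s void_events >>.
Proof.
move=> /separable_seq[q qP].
pose M := g_sigma_algebraType void_events.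
have VU (F : nat -> set M) : (forall n, measurable (F n)) ->
  measurable (\bigcup_n F n) by exact: bigcupT_measurable.
have mpos A : measurable A -> measurable ([set x | (0 < npoints A x)%N] : set M).
  move=> mA; rewrite [X in measurable X](_ : _ =
      ~` [set x | npoints A x = 0%N]); last first.
    by apply/seteqP; split=> x /=; rewrite lt0n => /eqP.
  by apply: measurableC; apply: sub_sigma_algebra; exists A.
have mge k : forall A, measurable A ->
    measurable ([set x | (k <= npoints A x)%N] : set M).
  elim: k => [|k IH] A mA.
    by rewrite [X in measurable X](_ : _ = setT)//; apply/seteqP; split.
  pose b n m : set (borel S) := [set z | mdist (q n) z < m.+1%:R^-1].
  rewrite [X in measurable X](_ : _ = \bigcup_n \bigcup_m
      ([set x | (0 < npoints (A `&` b n m) x)%N] `&`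
       [set x | (k <= npoints (A `\` b n m) x)%N])); last first.
    apply/seteqP; split=> x /=; last first.
      by move=> [n _ [m _ [/= p1 pk]]]; rewrite (npoints_setID A (b n m)) -add1n leq_add.
    move=> kx; have /npoints_gt0P[z zx Az] := leq_trans (ltn0Sn k) kx.
    (* All other points of [x] are farther than [e] from [z], so a base ball containing [z] with
       radius below [e / 2] contains no other point of [x]. *)
    have [y|e e0 He] := @finite_dist_gap _ _ z [seq y <- x | y != z] 0.
      by rewrite mem_filter mdist_gt0 eq_sym => /andP[].
    have e20 : 0 < e / 2 by rewrite divr_gt0.
    have [m _ /(_ m (leqnn m))/= me] := near_infty_natSinv_lt (PosNum e20).
    have [n nz] := qP z m.+1%:R^-1 ltac:(by rewrite invr_gt0).
    exists n => //; exists m => //; split=> /=.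
      by apply/npoints_gt0P; exists z.
    suff : (npoints (A `&` b n m) x <= 1)%N.
      move: kx; rewrite (npoints_setID A (b n m)) => kx1 le1.
      by rewrite -ltnS (leq_trans kx1)// -[X in (_ <= X)%N]add1n leq_add2r.
    rewrite -(cardfs1 z); apply: fsubset_leq_card; apply/fsubsetP => y.
    rewrite !inE => /andP[yx]; rewrite inE => -[_ /= ny].
    apply: contraT => yz.
    have : 0 + e < mdist z y by apply: He; rewrite mem_filter yz.
    have := metric_triangle z (q n) y; rewrite (metric_sym z (q n)).
    by move: nz ny me; rewrite /b/=; move: (m.+1%:R^-1) => t; lra.
  apply: (VU) => n; apply: (VU) => m; apply: measurableI.
    by apply: mpos; apply: measurableI => //; exact: measurable_mball.
  by apply: IH; apply: measurableD => //; exact: measurable_mball.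
apply/seteqP; split; last first.
  apply: smallest_sub; first exact: sigma_algebra_measurable.
  move=> _ [A mA <-]; apply: sub_sigma_algebra.
  by exists A => //; exists [set 0%N].
apply: smallest_sub => // _ [A mA [K _ <-]].
rewrite (_ : _ @^-1` K = \bigcup_(k in K)
    ([set x | (k <= npoints A x)%N] `\` [set x | (k.+1 <= npoints A x)%N])).
  apply: (@bigcup_measurable _ M) => k _; apply: measurableD; exact: mge.
apply/seteqP; split=> x /=.
  by move=> Kx; exists (npoints A x) => //; split=> //=; rewrite ltnn.
move=> [k Kk [/= kx /negP]]; rewrite -leqNgt => xk.
by have -> : npoints A x = k by apply/eqP; rewrite eqn_leq xk.
Qed.

End CountingVariables.

(** * The Hausdorff distance on finite configurations *)

Section Hausdorff.
Context {R : realType} {S : pmetricType R}.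
Implicit Types (x y : {fset S}).

(** The infimum over a finite set is attained: if every point were farther than [r], the gap would
    push the infimum above [r]. *)
Lemma dist_to_leP (a : S) y (r : R) : y != fset0 ->
  (dist_to a y <= r%:E)%E <-> exists2 b, b \in y & mdist a b <= r.
Proof.
move=> y0; split; last first.
  move=> [b by_ ab]; apply: (@le_trans _ _ (mdist a b)%:E); last by rewrite lee_fin.
  by apply: ereal_inf_lbound; exists b.
move=> H; apply: contrapT => nb.
have [b by_|e e0 He] := @finite_dist_gap _ _ a y r.
  by rewrite ltNge; apply/negP => ab; apply: nb; exists b.
move: H; apply/negP; rewrite -ltNge.
apply: (@lt_le_trans _ _ (r + e)%:E); first by rewrite lte_fin ltrDl.
by apply: le_ereal_inf_tmp => _ [b by_ <-]; rewrite lee_fin ltW// He.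
Qed.

(** The conventions for the empty configuration fit: if both are empty the conditions are vacuous,
    and if only one is, a condition fails. *)
Lemma hausdorff_dist_leP x y (r : R) : 0 <= r ->
  (hausdorff_dist x y <= r%:E)%E <->
  (forall a, a \in x -> exists2 b, b \in y & mdist a b <= r) /\
  (forall b, b \in y -> exists2 a, a \in x & mdist b a <= r).
Proof.
move=> r0; rewrite /hausdorff_dist.
have [->|x0] := eqVneq x fset0.
  have [->|y0] := eqVneq y fset0.
    by rewrite lee_fin r0; split.
  split=> // -[_ H].
  by have [b /H[a]] := fset0Pn _ y0.
have [->|y0] := eqVneq y fset0.
  by split=> // -[H _]; have [b /H[a]] := fset0Pn _ x0.
rewrite ge_max; split=> [/andP[H1 H2]|[H1 H2]].
  split=> a ax; apply/dist_to_leP => //.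
    by apply: le_trans H1; apply: ereal_sup_ubound; exists a.
  by apply: le_trans H2; apply: ereal_sup_ubound; exists a.
apply/andP; split; apply: ge_ereal_sup => _ [a ax <-]; apply/dist_to_leP => //.
  exact: H1.
exact: H2.
Qed.

(** Distance above [r] means that a point of one configuration is farther than [r] from all of the
    other. A countable base witnesses this: a small ball [b n m] meets the first configuration while
    the enlarged ball [c n m] misses the second. The complement is thus a countable union of
    products of counting events. *)
Lemma measurable_hausdorff_dist_le (r : R) : separable S -> 0 <= r ->
  measurable [set xy : config S * config S |
    (hausdorff_dist xy.1 xy.2 <= r%:E)%E].
Proof.
move=> /separable_seq[q qP] r0.
pose b n m : set (borel S) := [set z | mdist (q n) z < m.+1%:R^-1].
pose c n m : set (borel S) := [set z | mdist (q n) z <= r + m.+1%:R^-1].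
pose F n m : set (config S) := [set x | (0 < npoints (b n m) x)%N].
pose G n m : set (config S) := [set x | npoints (c n m) x = 0%N].
have mF n m : measurable (F n m).
  rewrite -[F n m]setTI; apply: (measurable_npoints _ measurableT (Y := [set k | (0 < k)%N])) => //.
  exact: measurable_mball.
have mG n m : measurable (G n m).
  rewrite -[G n m]setTI; apply: (measurable_npoints _ measurableT (Y := [set 0%N])) => //.
  exact: measurable_mcball.
have FGP x y : (exists a, a \in x /\ forall b, b \in y -> r < mdist a b) <->
    exists n m, F n m x /\ G n m y.
  split=> [[a [ax ay]]|[n [m [/npoints_gt0P[a ax /= na] /npoints0P Gy]]]].
    have [e e0 He] := finite_dist_gap ay.
    have e20 : 0 < e / 2 by rewrite divr_gt0.
    have [m _ /(_ m (leqnn m))/= me] := near_infty_natSinv_lt (PosNum e20).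
    have [n na] := qP a m.+1%:R^-1 ltac:(by rewrite invr_gt0).
    exists n, m; split; first by apply/npoints_gt0P; exists a.
    apply/npoints0P => d /He ad /= nd.
    have := metric_triangle a (q n) d; rewrite (metric_sym a (q n)).
    by move: nd na me; rewrite /c/=; move: (m.+1%:R^-1) => t; lra.
  exists a; split=> // d dy; rewrite ltNge; apply/negP => ad.
  apply: (Gy d dy) => /=; have := metric_triangle (q n) a d.
  by move: na ad; rewrite /b /c /=; move: (m.+1%:R^-1) => t; lra.
rewrite [X in measurable X](_ : _ =
  ~` ((\bigcup_n \bigcup_m (F n m `*` G n m)) `|`
      (\bigcup_n \bigcup_m (G n m `*` F n m)))); last first.
  apply/seteqP; split => [[x y]/=|[x y] /= H].
    move=> /(hausdorff_dist_leP _ _ r0)[Hx Hy] [] [n _ [m _ [/= h1 h2]]].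
      have [|a [ax ay]] := (FGP x y).2; first by exists n, m.
      by have [d /ay + /le_lt_trans] := Hx a ax => /[swap] /[apply]; rewrite ltxx.
    have [|a [ax ay]] := (FGP y x).2; first by exists n, m.
    by have [d /ay + /le_lt_trans] := Hy a ax => /[swap] /[apply]; rewrite ltxx.
  apply/(hausdorff_dist_leP _ _ r0); split=> a ax; apply: contrapT => na; apply: H.
    left; have [|n [m [h1 h2]]] := (FGP x y).1; last by exists n => //; exists m.
    exists a; split=> // d dy; rewrite ltNge; apply/negP => ad.
    by apply: na; exists d.
  right; have [|n [m [h1 h2]]] := (FGP y x).1; last by exists n => //; exists m.
  exists a; split=> // d dy; rewrite ltNge; apply/negP => ad.
  by apply: na; exists d.
apply: measurableC; apply: measurableU; apply: bigcupT_measurable => n;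
  by apply: bigcupT_measurable => m; exact: measurableX.
Qed.

End Hausdorff.

(** * Simple functions through their level sets *)

Section SimpleLevels.
Context d (T : measurableType d) (R : realType).
Import HBNNSimple.

Lemma nnsfun_levels (h : {nnsfun T >-> R}) :
  exists n (r : nat -> R), [/\ forall i, 0 <= r i,
    trivIset `I_n (fun i => h @^-1` [set r i]) &
    forall t, exists2 i, (i < n)%N & h t = r i].
Proof.
pose s : seq R := fset_set (range h).
exists (size s), (nth 0 s); split.
- move=> i; have [si|si] := ltnP i (size s); last by rewrite nth_default.
  have : nth 0 s i \in fset_set (range h) by exact: mem_nth.
  by rewrite in_fset_set// inE => -[t _ <-].
- move=> i j /= si sj [t [/= hi hj]]; apply/eqP.
  by rewrite -(nth_uniq 0 si sj (fset_uniq _)) -hi -hj.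
- move=> t; have ts : h t \in s by rewrite in_fset_set//; apply/mem_set; exists t.
  by exists (index (h t) s); rewrite ?index_mem// nth_index.
Qed.

Lemma indic_levels (h : {nnsfun T >-> R}) n (r : nat -> R) t :
  trivIset `I_n (fun i => h @^-1` [set r i]) ->
  (exists2 i, (i < n)%N & h t = r i) ->
  exists i0 : 'I_n, h t = r i0 /\
    forall i : 'I_n, (t \in h @^-1` [set r i]) = (i == i0).
Proof.
move=> tr [i ilt hti]; exists (Ordinal ilt); split=> // j.
apply/idP/eqP => [/set_mem/= hj|->]; last by rewrite inE.
by apply: val_inj => /=; apply: (tr _ _ (ltn_ord j) ilt); exists t.
Qed.

Lemma integral_nnsfun_levels (L : {measure set T -> \bar R})
    (h : {nnsfun T >-> R}) n (r : nat -> R) :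
  (forall i, 0 <= r i) -> trivIset `I_n (fun i => h @^-1` [set r i]) ->
  (forall t, exists2 i, (i < n)%N & h t = r i) ->
  (\int[L]_t (h t)%:E = \sum_(i < n) (r i)%:E * L (h @^-1` [set r i]))%E.
Proof.
move=> r0 tr cov.
transitivity (\int[L]_t (\sum_(i < n) (r i * \1_(h @^-1` [set r i]) t)%:E))%E.
  apply: eq_integral => t _; rewrite sumEFin; congr (_%:E).
  have [i0 [hi0 Hi]] := indic_levels tr (cov t).
  rewrite (bigD1 i0)//= big1 => [|i ii0]; last by rewrite indicE Hi (negbTE ii0) mulr0.
  by rewrite indicE Hi eqxx mulr1 addr0.
rewrite ge0_integral_sum//; last 2 first.
- by move=> i; apply/measurable_EFinP; apply: measurable_funM => //.
- by move=> i t _; rewrite lee_fin mulr_ge0.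
apply: eq_bigr => i _; under eq_integral do rewrite EFinM.
rewrite ge0_integralZl//.
- by rewrite integral_indic// setIT.
- exact/measurable_EFinP.
- by rewrite lee_fin.
Qed.

End SimpleLevels.

(** * The Laplace functional of a Poisson process *)

Section Laplace.
Context {R : realType} {S : pmetricType R}.
Implicit Types (w : S -> R) (x : {fset S}).
Import HBNNSimple.

(** Its mean under the law of a point process is the generating functional at [w], which is the
    Laplace functional at [u] when [w = exp (- u)]. *)
Definition config_prod w x : R := \prod_(z <- x) w z.

Lemma config_prod_ge0 w x : (forall z, 0 <= w z) -> 0 <= config_prod w x.
Proof. by move=> w0; apply: prodr_ge0. Qed.

Lemma config_prodM w v x :
  config_prod (fun z => w z * v z) x = config_prod w x * config_prod v x.
Proof. by rewrite /config_prod big_split. Qed.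

(** Grouping the points of [x] by the value of [h] leaves finitely many counts in disjoint sets. *)
Lemma config_prod_levels (h : {nnsfun borel S >-> R}) n (r : nat -> R) x :
  trivIset `I_n (fun i => h @^-1` [set r i]) ->
  (forall t, exists2 i, (i < n)%N & h t = r i) ->
  config_prod h x = \prod_(i < n) r i ^+ npoints (h @^-1` [set r i]) x.
Proof.
move=> tr cov; rewrite /config_prod.
under [RHS]eq_bigr do rewrite npointsE expr_sum.
rewrite exchange_big/=; apply: eq_bigr => z _.
have [i0 [hi0 Hi]] := indic_levels tr (cov z).
rewrite (bigD1 i0)//= big1 => [|i ii0]; last by rewrite Hi (negbTE ii0) expr0.
by rewrite Hi eqxx mulr1 expr1.
Qed.

Let approx w (mw : measurable_fun [set: borel S] w) :=
  nnsfun_approx measurableT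
   ((measurable_EFinP _ _).2 mw : measurable_fun [set: borel S] (EFin \o w)).

Let approx_cvg w mw z : (forall z, 0 <= w z) ->
  (@approx w mw n z) @[n --> \oo] --> w z.
Proof.
move=> w0; have w0' (t : borel S) : setT t -> (0 <= (EFin \o w) t)%E by rewrite lee_fin.
exact: fine_cvg (cvg_nnsfun_approx _ _ w0' I).
Qed.

Let measurable_config_prod_nnsfun (h : {nnsfun borel S >-> R}) :
  measurable_fun [set: config S] (config_prod h : config S -> R).
Proof.
have [n [r [_ tr cov]]] := nnsfun_levels h.
apply: (eq_measurable_fun (fun x : config S =>
    \prod_(i < n) r i ^+ npoints (h @^-1` [set r i]) x)).
  by move=> x _; rewrite (config_prod_levels _ tr cov).
apply: measurable_prod => i _.
apply: (measurableT_comp (f := fun k : nat => r i ^+ k)) => //.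
exact: measurable_npoints.
Qed.

Let config_prod_cvg w mw x : (forall z, 0 <= w z) ->
  config_prod (@approx w mw n) x @[n --> \oo] --> config_prod w x.
Proof.
move=> w0; apply: cvg_big => [|z _]; last exact: approx_cvg.
exact: mul_continuous.
Qed.

Lemma measurable_config_prod w : (forall z, 0 <= w z) ->
  measurable_fun [set: borel S] w ->
  measurable_fun [set: config S] (config_prod w : config S -> R).
Proof.
move=> w0 mw.
apply: (@measurable_fun_cvg _ (config S) R setT
  (fun n => config_prod (approx mw n))) => // x _.
exact: config_prod_cvg.
Qed.

(* [Q] is [p] times the law of a Poisson process with mean measure [L]. *)
Definition poisson_law (Q : {measure set (config S) -> \bar R}) (p : R)
    (L : {measure set (borel S) -> \bar R}) : Prop :=
  forall n (A : nat -> set (borel S)) (K : nat -> set nat),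
  (forall i, measurable (A i)) -> trivIset `I_n A ->
  Q [set x | forall i, (i < n)%N -> K i (npoints (A i) x)] =
  (p%:E * \prod_(i < n) poisson_prob (fine (L (A i))) 0 (K i))%E.

Variables (Q : {measure set (config S) -> \bar R}) (p : R).
Variable (L : {measure set (borel S) -> \bar R}).
Hypothesis p0 : 0 <= p.
Hypothesis Q_poisson : poisson_law Q p L.
Hypothesis L_fin : (L setT < +oo)%E.

Let Lfin A : measurable A -> L A \is a fin_num.
Proof.
move=> mA; rewrite ge0_fin_numE// (le_lt_trans _ L_fin)//.
by apply: le_measure; rewrite ?inE.
Qed.

(** The counts in the level sets are independent Poisson variables of means [m i], each contributing
    the factor [expR (r i * m i - m i)]. Since the level sets partition the space, the [m i] sum to
    the total mass. *)
Let laplace_nnsfun (h : {nnsfun borel S >-> R}) :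
  (\int[Q]_x (config_prod h x)%:E =
   (p * expR (fine (\int[L]_z (h z)%:E) - fine (L setT)))%:E)%E.
Proof.
have [n [r [r0 tr cov]]] := nnsfun_levels h.
pose m i := fine (L (h @^-1` [set r i])).
have m0 i : 0 <= m i by exact: fine_ge0.
have LC i : L (h @^-1` [set r i]) = (m i)%:E by rewrite fineK// Lfin.
transitivity (\int[Q]_(x in setT)
    (\prod_(i < n) r i ^+ npoints (h @^-1` [set r i]) x)%:E)%E.
  by apply: eq_integral => x _; rewrite (config_prod_levels _ tr cov).
rewrite (@integral_prod_nat_rv _ _ _ Q (fun i => npoints (h @^-1` [set r i]))
   (fun i k => m i ^+ k / k`!%:R * expR (- m i)) (fun i k => r i ^+ k)
   (fun i => expR (r i * m i - m i)) _ _ _ _ n setT p)//.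
- rewrite -expR_sum (integral_nnsfun_levels L r0 tr cov) sumrB.
  have -> : (\sum_(i < n) (r i)%:E * L (h @^-1` [set r i]) =
      (\sum_(i < n) r i * m i)%:E)%E.
    by rewrite -sumEFin; apply: eq_bigr => i _; rewrite LC EFinM.
  suff -> : (L setT = (\sum_(i < n) m i)%:E)%E by [].
  pose C i := h @^-1` [set r i].
  have CT : setT = \big[setU/set0]_(i < n) C i.
    apply/esym; rewrite -subTset => z _; rewrite -(bigcup_mkord n C).
    by have [i ni hi] := cov z; exists i.
  have mC k : measurable (C k) by exact: measurable_funPTI.
  rewrite CT measure_semi_additive_ord_I//; last by rewrite -CT.
  by rewrite -sumEFin; apply: eq_bigr => i _; rewrite -LC.
- by move=> i; apply: measurable_npoints.
- by move=> i k; rewrite !mulr_ge0 ?expR_ge0// exprn_ge0.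
- by move=> i k; rewrite exprn_ge0.
- by move=> i; exact: nneseries_poisson_generating.
- move=> k; rewrite setTI (@Q_poisson n (fun i => h @^-1` [set r i]) (fun i => [set k i]))//.
  rewrite EFinM; congr (_ * _)%E.
  by under eq_bigr do rewrite poisson_prob_set1//; rewrite prodEFin.
Qed.

(** Increasing simple functions approximate [w], and products of nonnegative factors increase with
    them, so both sides pass to the limit by monotone convergence. *)
Lemma laplace_functional w (c : R) : measurable_fun [set: borel S] w ->
  (forall z, 0 <= w z <= c) ->
  (\int[Q]_x (config_prod w x)%:E =
   (p * expR (fine (\int[L]_z (w z)%:E) - fine (L setT)))%:E)%E.
Proof.
move=> mw w0c.
have w0 z : 0 <= w z by case/andP: (w0c z).
have wc z : w z <= c by case/andP: (w0c z).
have mwE : measurable_fun [set: borel S] (EFin \o w) by exact/measurable_EFinP.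
have nd z : {homo (fun n => approx mw n z) : a b / (a <= b)%N >-> a <= b}.
  by move=> a b ab; exact/lefP/nd_nnsfun_approx.
(* The bound [c] and the finite mass of [L] keep the integral finite, so that [fine] and then [expR]
   are continuous along the approximation. *)
have If : (\int[L]_z (w z)%:E \is a fin_num)%E.
  rewrite ge0_fin_numE; last by apply: integral_ge0 => z _; rewrite lee_fin.
  apply: (@le_lt_trans _ _ (\int[L]_z c%:E)%E).
    apply: ge0_le_integral => //.
    - by move=> z _; rewrite lee_fin.
    - by move=> z _; rewrite lee_fin.
  rewrite integral_cst// lte_mul_pinfty// lee_fin.
  exact: le_trans (w0 point) (wc point).
have lhs : (\int[Q]_x (config_prod (approx mw n) x)%:E @[n --> \oo] -->
    \int[Q]_x (config_prod w x)%:E)%E.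
  have -> : (\int[Q]_x (config_prod w x)%:E =
     \int[Q]_x limn (fun n => (config_prod (approx mw n) x)%:E))%E.
    apply: eq_integral => x _; apply/esym/cvg_lim => //.
    by apply: cvg_EFin; [exact: nearW|exact: config_prod_cvg].
  apply: cvg_monotone_convergence => //.
  - by move=> n; apply/measurable_EFinP; exact: measurable_config_prod_nnsfun.
  - by move=> n x _; rewrite lee_fin config_prod_ge0.
  - move=> x _ a b ab; rewrite lee_fin; apply: ler_prod => z _.
    by rewrite fun_ge0/= nd.
have rhs : (\int[L]_z (approx mw n z)%:E @[n --> \oo] --> \int[L]_z (w z)%:E)%E.
  have -> : (\int[L]_z (w z)%:E = \int[L]_z limn (fun n => (approx mw n z)%:E))%E.
    apply: eq_integral => z _; apply/esym/cvg_lim => //.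
    by apply: cvg_EFin; [exact: nearW|exact: approx_cvg].
  apply: cvg_monotone_convergence => //.
  - by move=> n; apply/measurable_EFinP.
  - by move=> n z _; rewrite lee_fin.
  - by move=> z _ a b ab; rewrite lee_fin nd.
have {}lhs : ((p * expR (fine (\int[L]_z (approx mw n z)%:E) -
    fine (L setT)))%:E @[n --> \oo] --> \int[Q]_x (config_prod w x)%:E)%E.
  by apply: cvg_trans lhs; apply: near_eq_cvg; apply: nearW => n;
    rewrite laplace_nnsfun.
apply: (cvg_unique _ lhs) => //.
apply: cvg_EFin; first exact: nearW.
apply: cvgMr.
apply: continuous_cvg; first exact: continuous_expR.
by apply: cvgB; [by apply: fine_cvg; rewrite fineK|exact: cvg_cst].
Qed.

End Laplace.

(** * Small Hausdorff balls and their mass under a Poisson law *)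

Section SmallBalls.
Context {R : realType} {S : pmetricType R}.
Implicit Types (x y : {fset S}) (r e : R).

Local Notation hball := (dist_ball (U := config S) hausdorff_dist).

(** The balls about the points of [x] and, at index 0, the region outside them form one family, so
    that [poisson_law] handles all counts at once. *)
Definition cell x r (i : nat) : set (borel S) :=
  if i is k.+1 then [set y | mdist (nth point x k) y <= r]
  else [set y | forall z, z \in x -> r < mdist z y].

(** This makes the closed balls of radius [r] about the points of [x] disjoint. *)
Definition spaced x r : Prop :=
  forall z z', z \in x -> z' \in x -> z != z' -> r + r < mdist z z'.

Lemma spaced_near x : \forall r \near 0^'+, spaced x r.
Proof.
suff [e e0 He] : exists2 e, 0 < e & forall z z', z \in x -> z' \in x -> z != z' ->
    e < mdist z z'.
  near=> r => z z' zx z'x zz'; apply: le_lt_trans (He _ _ zx z'x zz').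
  suff : r < e / 2 by lra.
  by near: r; apply: nbhs_right_lt; rewrite divr_gt0.
suff [e e0 He] : exists2 e, 0 < e & forall z z', z \in (x : seq S) -> z' \in x ->
    z != z' -> e < mdist z z' by exists e.
move: (x : seq S) => s; elim: s => [|z s [e e0 He]]; first by exists 1.
have [t|e1 e10 He1] := @finite_dist_gap _ _ z [seq t <- x | t != z] 0.
  by rewrite mem_filter mdist_gt0 eq_sym => /andP[].
exists (Num.min e e1); first by rewrite lt_min e0.
move=> a b; rewrite inE gt_min => /predU1P[->|as_] bx ab.
  apply/orP; right; rewrite -[e1]add0r; apply: He1.
  by rewrite mem_filter bx eq_sym ab.
by rewrite He.
Unshelve. all: by end_near. Qed.

Lemma measurable_cell x r i : measurable (cell x r i).
Proof.
case: i => [|i]; last exact: measurable_mcball.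
rewrite [X in measurable X](_ : _ = ~` \bigcup_(k in [set k | (k < #|` x|)%N])
    [set y | mdist (nth point x k) y <= r]).
  apply: measurableC; apply: bigcup_measurable => k _; exact: measurable_mcball.
apply/seteqP; split=> y /= H.
  move=> [k /= kx]; apply/negP; rewrite -ltNge; apply: H; exact: mem_nth.
move=> z zx; rewrite ltNge; apply/negP => zy; apply: H.
by exists (index z x); rewrite /= ?index_mem// nth_index.
Qed.

Lemma trivIset_cell x r : spaced x r ->
  trivIset `I_(#|` x|).+1 (cell x r).
Proof.
have key i (y : S) : (i < #|` x|)%N -> ~ (cell x r 0 y /\ cell x r i.+1 y).
  by move=> ix /= [H]; apply/negP; rewrite -ltNge H// mem_nth.
move=> sep [|i] [|j] //= ix jx [y [yi yj]].
- by case: (key j y).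
- by case: (key i y).
congr _.+1; apply/eqP; rewrite -(nth_uniq point _ _ (fset_uniq x))//.
apply/negPn/negP => ij.
have := sep _ _ (mem_nth point (ix : (i < size x)%N)) (mem_nth point (jx : (j < size x)%N)) ij.
apply/negP; rewrite -leNgt.
rewrite (le_trans (metric_triangle _ y _))// lerD// metric_sym//.
Qed.

Definition one_each x r : set (config S) :=
  [set y | forall i, (i < (#|` x|).+1)%N -> npoints (cell x r i) y = (i != 0)%N].

(** No point outside the balls and at least one in each: the Hausdorff ball becomes an event on
    counts. *)
Lemma hausdorff_ballE x r : 0 <= r ->
  hball x r = [set y : config S | forall i,
    (i < (#|` x|).+1)%N -> (if i is 0%N then [set 0%N] else [set k | (0 < k)%N])
       (npoints (cell x r i) y)].
Proof.
move=> r0; apply/seteqP; split => y.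
  move=> /(hausdorff_dist_leP _ _ r0)[Hx Hy] [_|i ix] /=.
    apply/npoints0P => b /Hy[a ax ba] /(_ _ ax).
    by rewrite metric_sym ltNge ba.
  apply/npoints_gt0P; have [b yb ab] := Hx _ (mem_nth point (ix : (i < size x)%N)).
  by exists b.
move=> H; apply/(hausdorff_dist_leP _ _ r0); split => [a ax|b yb].
  have ix : (index a x < #|` x|)%N by rewrite index_mem.
  have /npoints_gt0P[b yb /=] := H (index a x).+1 ix.
  by rewrite nth_index//; exists b.
have /= /npoints0P/(_ b yb) nb := H 0%N (ltn0Sn _).
apply: contrapT => na; apply: nb => z zx; rewrite ltNge; apply/negP => zb.
by apply: na; exists z => //; rewrite metric_sym.
Qed.

Lemma measurable_one_each x r : measurable (one_each x r).
Proof.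
rewrite (_ : one_each x r = \bigcap_(i in [set i | (i < (#|` x|).+1)%N])
   (npoints (cell x r i) @^-1` [set (i != 0)%N : nat])); last first.
  by apply/seteqP; split.
apply: bigcap_measurable => [|i _]; first by exists 0%N.
rewrite -[X in measurable X]setTI.
by apply: measurable_npoints => //; exact: measurable_cell.
Qed.

Lemma one_each_ball x r : 0 <= r ->
  one_each x r `<=` hball x r.
Proof.
move=> r0 y H; rewrite hausdorff_ballE// => -[|i] ix /=.
  exact: H 0%N ix.
by rewrite (H i.+1 ix).
Qed.

(** The use of [perm_eq] turns a product over [y] into one over the fixed list [x]. *)
Definition perturbation x r : set {fset S} :=
  [set y | exists2 phi : S -> S, forall z, z \in x -> mdist z (phi z) <= r &
    perm_eq y (map phi x)].

(** Let [phi z] be the only point of [y] within [r] of [z]. Spacing makes [phi] injective on [x],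
    and the absence of points outside the balls makes it onto [y]. *)
Lemma one_each_perturbation x r : spaced x r ->
  one_each x r `<=` perturbation x r.
Proof.
move=> sep y H.
have N0 := H 0%N (ltn0Sn _).
have N1 z : z \in x -> npoints [set b | mdist z b <= r] y = 1%N.
  move=> zx; have ix : (index z x < #|` x|)%N by rewrite index_mem.
  by have := H (index z x).+1 ix; rewrite /= nth_index.
have uniq1 z b b' : z \in x -> b \in y -> b' \in y ->
    mdist z b <= r -> mdist z b' <= r -> b = b'.
  move=> /N1 /eqP; rewrite /npoints => /cardfs1P[c yc] by_ by' zb zb'.
  have : b \in [fset z0 in y | z0 \in [set b | mdist z b <= r]]%fset.
    by rewrite !inE by_ mem_set.
  have : b' \in [fset z0 in y | z0 \in [set b | mdist z b <= r]]%fset.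
    by rewrite !inE by' mem_set.
  by rewrite yc !inE => /eqP -> /eqP ->.
pose phi z := xget z [set b | b \in y /\ mdist z b <= r].
have phiP z : z \in x -> phi z \in y /\ mdist z (phi z) <= r.
  move=> zx; rewrite /phi; case: xgetP => [b -> //|nb].
  have : (0 < npoints [set b | (mdist z b <= r)%R] y)%N by rewrite N1.
  by move=> /npoints_gt0P[b by_ zb]; have := nb b; case.
exists phi; first by move=> z /phiP[].
apply: uniq_perm; first exact: fset_uniq.
  rewrite map_inj_in_uniq ?fset_uniq// => z z' zx z'x phizz'.
  apply/eqP/negPn/negP => zz'.
  have := sep _ _ zx z'x zz'; apply/negP; rewrite -leNgt.
  rewrite (le_trans (metric_triangle _ (phi z) _))// lerD ?(phiP z zx).2//.
  by rewrite phizz' metric_sym (phiP z' z'x).2.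
move=> b; apply/idP/mapP => [yb|[z zx ->]]; last by case: (phiP z zx).
move/npoints0P : N0 => /(_ b yb)/= nb.
apply: contrapT => nz; apply: nb => z zx; rewrite ltNge; apply/negP => zb.
apply: nz; exists z => //; apply: (uniq1 z) => //; by case: (phiP z zx).
Qed.

(** Hausdorff neighbourhoods of [x] may contain configurations with several points close to one
    point of [x], along which [config_prod w] need not converge; here the number of points is that
    of [x]. *)
Definition perturbation_filter x : set_system {fset S} :=
  filter_from [set r : R | 0 < r] (perturbation x).

Lemma perturbation_filter_filter x : Filter (perturbation_filter x).
Proof.
apply: filter_from_filter; first by exists 1 => /=.
move=> r r' /= r0 r'0; exists (Num.min r r'); first by rewrite /= lt_min r0.
by move=> y [phi Hphi yphi]; split; exists phi => // z zx;
  apply: le_trans (Hphi z zx) _; rewrite ge_min lexx ?orbT.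
Qed.

Lemma cvg_config_prod w x : continuous w ->
  config_prod w y @[y --> perturbation_filter x] --> config_prod w x.
Proof.
move=> cw.
(* Convergence is proved along displacement maps [phi] close to the identity on [x], where the
   product has a fixed finite index list. *)
pose G : set_system (S -> S) := filter_from [set r : R | 0 < r]
  (fun r => [set phi | forall z, z \in x -> mdist z (phi z) <= r]).
have GF : Filter G.
  apply: filter_from_filter; first by exists 1 => /=.
  move=> r r' /= r0 r'0; exists (Num.min r r'); first by rewrite /= lt_min r0.
  by move=> phi Hphi; split => z zx;
    apply: le_trans (Hphi z zx) _; rewrite ge_min lexx ?orbT.
have cG : \prod_(z <- x | z \in x) w (phi z) @[phi --> G] -->
    \prod_(z <- x | z \in x) w z.
  apply: cvg_big => [|z zx]; first exact: mul_continuous.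
  apply: (cvg_comp (fun phi : S -> S => phi z) w) (cw z).
  move=> A /nbhs_ballP[e /= e0 He]; exists (e / 2); first by rewrite /= divr_gt0.
  move=> phi Hphi; apply: He; rewrite ballEmdist /=.
  rewrite (le_lt_trans (Hphi z zx))//; lra.
move=> A; rewrite /config_prod [X in nbhs X]big_seq => /cG[r /= r0 Hr].
exists r => // y [phi Hphi yphi] /=.
rewrite (perm_big _ yphi)/= big_map big_seq.
exact: Hr.
Qed.

(** Closed balls decrease to their centre, so this is continuity from above of a finite measure. *)
Lemma cvg_measure_mcball (L : {measure set (borel S) -> \bar R}) z :
  (L setT < +oo)%E -> L [set z] = 0%E ->
  fine (L [set y | mdist z y <= r]) @[r --> 0^'+] --> 0.
Proof.
move=> Loo Lz.
pose F n : set (borel S) := [set y | mdist z y <= n.+1%:R^-1].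
have mF n : measurable (F n) by exact: measurable_mcball.
have Lfin r : (L [set y | (mdist z y <= r)%R] \is a fin_num)%E.
  rewrite ge0_fin_numE// (le_lt_trans _ Loo)// le_measure ?inE//.
  exact: measurable_mcball.
have : L (F n) @[n --> \oo] --> L (\bigcap_n F n).
  apply: nonincreasing_cvg_mu => //.
  - by rewrite -ge0_fin_numE//; exact: Lfin.
  - exact: bigcapT_measurable.
  - move=> m n mn; apply/subsetPset => y /= /le_trans; apply.
    by rewrite lef_pV2 ?posrE// ler_nat.
have -> : \bigcap_n F n = [set z].
  apply/seteqP; split => [y /= H|y -> n _ /=]; last by rewrite /F/= mdistxx.
  apply/esym/mdist_positivity/eqP; rewrite eq_le mdist_ge0 andbT.
  apply/ler_addgt0Pr => e e0; rewrite add0r.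
  have [n _ /(_ n (leqnn n))/= ne] := near_infty_natSinv_lt (PosNum e0).
  by rewrite (le_trans (H n I))// ltW.
rewrite Lz => /fine_cvg/cvgrPdist_lt H.
apply/cvgrPdist_lt => e e0.
have [n _ /(_ n (leqnn n)) /=] := H e e0.
rewrite sub0r normrN ger0_norm ?fine_ge0// => ne.
apply/near_right0P; exists n => r r0 rn.
rewrite sub0r normrN ger0_norm ?fine_ge0//; apply: le_lt_trans ne.
apply: fine_le; rewrite ?Lfin//; apply: le_measure; rewrite ?inE//.
  exact: measurable_mcball.
by move=> y /= /le_trans; apply; rewrite ltW.
Qed.

Lemma cvg_measure_mcballs (L : {measure set (borel S) -> \bar R}) x :
  (L setT < +oo)%E -> (forall z, L [set z] = 0%E) ->
  \sum_(i < #|` x|) fine (L (cell x r i.+1)) @[r --> 0^'+] --> (0 : R).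
Proof.
move=> Loo Lz; rewrite [X in _ --> X](_ : _ = \sum_(i < #|` x|) 0); last by rewrite big1.
apply: cvg_big => [|i _]; first exact: add_continuous.
exact: (@cvg_measure_mcball L (nth point x i) Loo (Lz _)).
Qed.

(** With [m i] the cell masses, the ball and its part [one_each] both have mass [p * expR (- m 0)]
    times a product over the points of [x], of the factors [1 - expR (- m i.+1)] and
    [m i.+1 * expR (- m i.+1)] respectively. Hence [one_each] fills at least the fraction
    [expR (- s) >= 1 - s] of the ball. *)
Lemma poisson_law_ball (Q : {measure set (config S) -> \bar R}) (p : R)
    (L : {measure set (borel S) -> \bar R}) x r :
  0 <= p -> poisson_law Q p L -> (L setT < +oo)%E -> 0 <= r -> spaced x r ->
  (Q (hball x r `\` one_each x r) <=
   (\sum_(i < #|` x|) fine (L (cell x r i.+1)))%:E *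
     Q (hball x r))%E.
Proof.
move=> p0 QL Loo r0 sep.
pose m i := fine (L (cell x r i)).
have m0 i : 0 <= m i by exact: fine_ge0.
set s := \sum_(i < _) _.
have mB : measurable (hball x r : set (config S)).
  rewrite hausdorff_ballE//.
  rewrite (_ : mkset _ = \bigcap_(i in [set i | (i < (#|` x|).+1)%N])
   (npoints (cell x r i) @^-1` (if i is 0%N then [set 0%N] else [set k | (0 < k)%N]))).
    apply: bigcap_measurable => [|i _]; first by exists 0%N.
    rewrite -[X in measurable X]setTI.
    by apply: measurable_npoints => //; exact: measurable_cell.
  by apply/seteqP; split.
have QB : Q (hball x r) =
    (p * (expR (- m 0) * \prod_(i < #|` x|) (1 - expR (- m i.+1))))%:E.
  rewrite hausdorff_ballE// (QL _ _ (fun i =>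
    if i is 0%N then [set 0%N] else [set k | (0 < k)%N]))//; last 2 first.
  - by move=> i; exact: measurable_cell.
  - exact: trivIset_cell.
  rewrite big_ord_recl/= EFinM; congr (_ * _)%E; rewrite EFinM; congr (_ * _)%E.
    by rewrite poisson_prob_set1// expr0 fact0 invr1 !mul1r.
  by under eq_bigr do rewrite poisson_prob_gt0//; rewrite prodEFin.
have QE : Q (one_each x r) =
    (p * (expR (- m 0) * \prod_(i < #|` x|) (m i.+1 * expR (- m i.+1))))%:E.
  rewrite (QL _ _ (fun i => [set (i != 0)%N : nat]))//; last 2 first.
  - by move=> i; exact: measurable_cell.
  - exact: trivIset_cell.
  rewrite big_ord_recl/= EFinM; congr (_ * _)%E; rewrite EFinM; congr (_ * _)%E.
    by rewrite poisson_prob_set1// expr0 fact0 invr1 !mul1r.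
  by under eq_bigr do rewrite poisson_prob_set1// expr1 divr1; rewrite prodEFin.
have QBoo : (Q (hball x r) < +oo)%E by rewrite QB ltry.
have -> : Q (hball x r `\` one_each x r) = (Q (hball x r) - Q (one_each x r))%E.
  have {2}<- : hball x r `&` one_each x r = one_each x r.
    by apply: setIidr; exact: one_each_ball.
  by apply: measureD => //; exact: measurable_one_each.
rewrite QB QE -EFinB -EFinM lee_fin.
set a := p * (_ * _); set b := p * (_ * _).
have a0 : 0 <= a.
  rewrite !mulr_ge0 ?expR_ge0//; apply: prodr_ge0 => i _.
  by rewrite subr_ge0 -expR0 ler_expR oppr_le0.
(* Each ball contributes [m exp (- m) >= exp (- m) (1 - exp (- m))]. *)
suff : (1 - s) * a <= b by lra.
apply: (@le_trans _ _ (expR (- s) * a)).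
  by rewrite ler_wpM2r//; exact: expR_ge1Dx.
rewrite mulrCA [in leRHS]/b ler_wpM2l// mulrCA ler_wpM2l ?expR_ge0//.
rewrite big_split/= -expR_sum sumrN -/s mulrC ler_wpM2r ?expR_ge0//.
apply: ler_prod => i _; apply/andP; split.
  by rewrite subr_ge0 -expR0 ler_expR oppr_le0.
have := expR_ge1Dx (- m i.+1); lra.
Qed.

End SmallBalls.

Lemma continuous_borel_measurable (R : realType) (S : pmetricType R) (f : S -> R) :
  continuous f -> measurable_fun [set: borel S] f.
Proof.
move=> cf; apply: (measurability _ (RGenOInfty.measurableE R)) => //.
move=> _ [_ [a ->] <-]; rewrite setTI; apply: sub_sigma_algebra.
by move/continuousP : cf; apply; exact: interval_open.
Qed.

Lemma compact_continuous_bounded (R : realType) (S : pmetricType R) (f : S -> R) :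
  compact [set: S] -> continuous f -> exists c, forall z, f z <= c.
Proof.
move=> cS cf.
have : compact (f @` [set: S]).
  by apply: continuous_compact => //; exact: continuous_subspaceT.
move=> /compact_bounded[M [_ HM]]; exists (M + 1) => z.
by apply: le_trans (ler_norm _) _; apply: (HM (M + 1)); [rewrite ltrDl|exists z].
Qed.

(** * Mutual densities of Poisson laws *)

Section Symmetry.
Context {R : realType} {S : pmetricType R}.
Variable nu : {measure set (borel S) -> \bar R}.

Definition intensity_measure (L : {measure set (borel S) -> \bar R})
    (f : S -> R) : Prop :=
  forall g : borel S -> \bar R, measurable_fun [set: borel S] g ->
    (forall z, (0 <= g z)%E) -> forall D, measurable D ->
  (\int[L]_(z in D) g z = \int[nu]_(z in D) (g z * (f z)%:E))%E.

Lemma measurable_npoints0 (A : set (borel S)) : measurable A ->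
  measurable ([set x | npoints A x = 0%N] : set (config S)).
Proof.
move=> mA; rewrite -[X in measurable X]setTI.
exact: (measurable_npoints mA measurableT (Y := [set 0%N])).
Qed.

(** The indicator of a void event is itself a product over the points, so integrals over void events
    are values of the Laplace functional. *)
Lemma config_prod_void (w : S -> R) (A : set S) (x : {fset S}) :
  config_prod (fun z => \1_(~` A) z * w z) x =
  \1_[set y | npoints A y = 0%N] x * config_prod w x.
Proof.
rewrite config_prodM; congr (_ * _); rewrite indicE.
have [/set_mem/npoints0P H|/negP H] := boolP (x \in _).
  rewrite /config_prod big_seq big1// => z zx.
  by rewrite indicE mem_set//; exact: H.
have /npoints_gt0P[z zx Az] : (0 < npoints A x)%N.
  by rewrite lt0n; apply/negP => /eqP x0; apply: H; rewrite inE.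
rewrite /config_prod (big_rem z)//= indicE memNset ?mul0r//.
Qed.

(** When [nu] is finite and [L] has density [f], this is, up to the factor [exp (nu S)], the density
    of [p] times the Poisson law of mean [L] with respect to the Poisson process of intensity 1. *)
Definition poisson_density (p : R) (L : {measure set (borel S) -> \bar R})
    (f : S -> R) (x : {fset S}) : R :=
  p * expR (- fine (L setT)) * config_prod f x.

Lemma poisson_density_ge0 p L (f : S -> R) x : 0 <= p -> (forall z, 0 <= f z) ->
  0 <= poisson_density p L f x.
Proof.
by move=> p0 f0; rewrite !mulr_ge0 ?expR_ge0//; exact: config_prod_ge0.
Qed.

Lemma measurable_poisson_density p L (f : S -> R) : (forall z, 0 <= f z) ->
  measurable_fun [set: borel S] f ->
  measurable_fun [set: config S] (poisson_density p L f : config S -> R).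
Proof.
by move=> f0 mf; apply: measurable_funM => //; exact: measurable_config_prod.
Qed.

(** The Laplace functional of [Q1] at [f2] cut off outside [A]; the density [f1] of [L1] turns its
    exponent into an integral of [f1 * f2], so the value is symmetric in the two laws. *)
Lemma integral_poisson_density_void (Q1 : {measure set (config S) -> \bar R})
    (L1 L2 : {measure set (borel S) -> \bar R}) (p1 p2 c : R) (f1 f2 : S -> R)
    (A : set (borel S)) :
  0 <= p1 -> 0 <= p2 -> poisson_law Q1 p1 L1 -> (L1 setT < +oo)%E ->
  intensity_measure L1 f1 -> (forall z, 0 <= f2 z <= c) ->
  measurable_fun [set: borel S] f2 -> measurable A ->
  (\int[Q1]_(x in [set x | npoints A x = 0%N]) (poisson_density p2 L2 f2 x)%:E =
   (p1 * p2 * expR (fine (\int[nu]_(z in ~` A) (f1 z * f2 z)%:E)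
      - fine (L1 setT) - fine (L2 setT)))%:E)%E.
Proof.
move=> p10 p20 Q1P L1oo f1L f2c mf2 mA.
have f20 z : 0 <= f2 z by case/andP: (f2c z).
have mw : measurable_fun [set: borel S] (fun z => \1_(~` A) z * f2 z).
  by apply: measurable_funM => //; apply: measurable_indic; exact: measurableC.
rewrite integral_mkcond epatch_indic.
transitivity (\int[Q1]_x ((p2 * expR (- fine (L2 setT)))%:E *
    (config_prod (fun z => \1_(~` A) z * f2 z) x)%:E))%E.
  apply: eq_integral => x _; rewrite /= /poisson_density config_prod_void -!EFinM.
  by congr (_%:E); ring.
rewrite ge0_integralZl//; last 3 first.
- apply/measurable_EFinP; apply: measurable_config_prod => //.
  by move=> z; rewrite mulr_ge0.
- by move=> x _; rewrite lee_fin config_prod_ge0// => z; rewrite mulr_ge0.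
- by rewrite lee_fin mulr_ge0 ?expR_ge0.
rewrite (laplace_functional p10 Q1P L1oo (c := c) mw); last first.
  move=> z; rewrite mulr_ge0//=; case/andP: (f2c z) => _; apply: le_trans.
  by rewrite ler_piMl// indicE lern1 leq_b1.
have -> : (\int[L1]_z (\1_(~` A) z * f2 z)%:E =
    \int[nu]_(z in ~` A) (f1 z * f2 z)%:E)%E.
  rewrite f1L//; last 2 first.
  - exact/measurable_EFinP.
  - by move=> z; rewrite lee_fin mulr_ge0.
  rewrite [RHS]integral_mkcond epatch_indic; apply: eq_integral => z _ /=.
  by rewrite -!EFinM; congr (_%:E); ring.
rewrite -EFinM; congr (_%:E); rewrite [in RHS]expRD; ring.
Qed.

(** The laws [Q1] weighted by the second density and [Q2] weighted by the first agree on the void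
    events, hence on the sigma-algebra they generate. *)
Lemma poisson_density_sym
    (Q1 Q2 : {measure set (config S) -> \bar R})
    (L1 L2 : {measure set (borel S) -> \bar R})
    (p1 p2 c : R) (f1 f2 : S -> R) :
  separable S -> 0 <= p1 -> 0 <= p2 ->
  poisson_law Q1 p1 L1 -> poisson_law Q2 p2 L2 ->
  (L1 setT < +oo)%E -> (L2 setT < +oo)%E ->
  intensity_measure L1 f1 -> intensity_measure L2 f2 ->
  (forall z, 0 <= f1 z <= c) -> (forall z, 0 <= f2 z <= c) ->
  measurable_fun [set: borel S] f1 -> measurable_fun [set: borel S] f2 ->
  forall (g : config S -> \bar R) (B : set (config S)),
  measurable_fun setT g -> (forall x, (0 <= g x)%E) -> measurable B ->
  (\int[Q1]_(x in B) (g x * (poisson_density p2 L2 f2 x)%:E) =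
   \int[Q2]_(x in B) (g x * (poisson_density p1 L1 f1 x)%:E))%E.
Proof.
move=> sepS p10 p20 Q1P Q2P L1oo L2oo f1L f2L f1c f2c mf1 mf2 g B mg g0 mB.
have f10 z : 0 <= f1 z by case/andP: (f1c z).
have f20 z : 0 <= f2 z by case/andP: (f2c z).
have [m1 [m1E m1I]] := density_measure Q1
  (measurable_poisson_density p2 L2 f20 mf2)
  (fun x => poisson_density_ge0 L2 x p20 f20).
have [m2 [m2E m2I]] := density_measure Q2
  (measurable_poisson_density p1 L1 f10 mf1)
  (fun x => poisson_density_ge0 L1 x p10 f10).
rewrite -m1I// -m2I//; apply: eq_measure_integral => A mA _.
have mV := measurable_npoints0.
(* The whole space is the void event of the empty set; this gives the exhausting sequence and the
   finite mass required by [measure_unique]. *)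
have V0 : [set x : config S | npoints set0 x = 0%N] = setT.
  by apply/seteqP; split => // x _; apply/npoints0P => z _ [].
apply: (measure_unique void_events (fun=> setT)) => //.
- exact: counting_events_void.
- exact: setI_closed_void_events.
- by move=> _; rewrite -V0; exists set0.
- by apply/seteqP; split => // x _; exists 0%N.
- move=> _ [C mC <-]; rewrite m1E ?m2E//; try exact: mV.
  rewrite (@integral_poisson_density_void Q1 L1 L2 p1 p2 c f1 f2)//.
  rewrite (@integral_poisson_density_void Q2 L2 L1 p2 p1 c f2 f1)//.
  congr (_%:E); rewrite (mulrC p1); congr (_ * expR _).
  under [in RHS]eq_integral do rewrite mulrC.
  by ring.
- move=> _; rewrite -V0 m1E; last exact: mV.
  by rewrite (@integral_poisson_density_void Q1 L1 L2 p1 p2 c f1 f2)// ltry.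
Qed.

End Symmetry.

(** On [B] the function is at most [e] inside [E] and at most [K] on the rest, whose relative mass
    is at most [s]. If [B] is null the left side is 0, as [0^-1 = 0]. *)
Lemma mean_deviation_le d (U : measurableType d) (R : realType)
    (mu : {finite_measure set U -> \bar R}) (B E : set U) (h : U -> R) (e K s : R) :
  measurable B -> measurable E -> measurable_fun [set: U] h ->
  0 <= e -> 0 <= K -> 0 <= s ->
  (forall y, 0 <= h y) -> (forall y, B y -> h y <= K) ->
  (forall y, E y -> h y <= e) ->
  (mu (B `\` E) <= s%:E * mu B)%E ->
  (fine (mu B))^-1 * \int[mu]_(y in B) h y <= e + K * s.
Proof.
move=> mB mE mh e0 K0 s0 h0 hK he BE.
have muB : mu B \is a fin_num by exact: fin_num_measure.
have mBE : measurable (B `\` E) by exact: measurableD.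
have muBE : mu (B `\` E) \is a fin_num by exact: fin_num_measure.
have [B0|B0] := eqVneq (fine (mu B)) 0.
  by rewrite B0 invr0 mul0r addr_ge0// mulr_ge0.
have {B0} Bpos : 0 < fine (mu B) by rewrite lt_neqAle eq_sym B0 fine_ge0.
rewrite mulrC ler_pdivrMr//.
have I1 : (\int[mu]_(y in B) (h y)%:E <=
    \int[mu]_(y in B) (e%:E + K%:E * (\1_(B `\` E) y)%:E))%E.
  apply: ge0_le_integral => //.
  - by move=> y _; rewrite lee_fin.
  - by apply/measurable_EFinP; exact: measurable_funTS.
  - apply: emeasurable_funD => //; apply: emeasurable_funM => //.
    by apply/measurable_EFinP; apply: measurable_indic.
  - move=> y By; rewrite -EFinM -EFinD lee_fin indicE.
    have [Ey|nEy] := pselect (E y).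
      by rewrite (le_trans (he _ Ey))// lerDl mulr_ge0.
    by rewrite mem_set//= mulr1 (le_trans (hK _ By))// lerDr.
have I2 : (\int[mu]_(y in B) (e%:E + K%:E * (\1_(B `\` E) y)%:E) =
    (e * fine (mu B) + K * fine (mu (B `\` E)))%:E)%E.
  have m1 : measurable_fun B (fun y => (\1_(B `\` E) y)%:E : \bar R).
    by apply/measurable_EFinP; exact: measurable_indic.
  rewrite ge0_integralD//; last 2 first.
  - by move=> y _; rewrite -EFinM lee_fin mulr_ge0.
  - exact: emeasurable_funM.
  rewrite integral_cst// ge0_integralZl//.
  rewrite integral_indic//.
  have -> : (B `\` E) `&` B = B `\` E by apply: setIidl; exact: subDsetl.
  by rewrite EFinD !EFinM !fineK.
have Ifin : (\int[mu]_(y in B) (h y)%:E)%E \is a fin_num.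
  rewrite ge0_fin_numE; last by apply: integral_ge0 => y _; rewrite lee_fin.
  by rewrite (le_lt_trans I1)// I2 ltry.
rewrite -lee_fin fineK// (le_trans I1)// I2 lee_fin mulrDl lerD2l -mulrA ler_wpM2l//.
by rewrite -lee_fin EFinM !fineK.
Qed.

(** * The mixture of the class laws and its posterior mean *)

Section Mixture.
Context {R : realType} {S : pmetricType R}.
Variable nu : {measure set (borel S) -> \bar R}.
Variables (n : nat) (p : nat -> R) (c : R) (f : nat -> S -> R).
Variables (L : nat -> {measure set (borel S) -> \bar R}).
Variables (Q : nat -> {measure set (config S) -> \bar R}).
Variable mu : {finite_measure set (config S) -> \bar R}.
Hypothesis S_separable : separable S.
Hypothesis p_gt0 : forall j, 0 < p j.
Hypothesis Q_poisson : forall j, poisson_law (Q j) (p j) (L j).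
Hypothesis L_fin : forall j, (L j setT < +oo)%E.
Hypothesis L_intensity : forall j, intensity_measure nu (L j) (f j).
Hypothesis f_bounded : forall j z, 0 <= f j z <= c.
Hypothesis f_cont : forall j, continuous (f j).
Hypothesis mu_mixture : forall A, measurable A -> (mu A = \sum_(j < n) Q j A)%E.

Let f0 j z : 0 <= f j z. Proof. by case/andP: (f_bounded j z). Qed.

Let mf j : measurable_fun [set: borel S] (f j).
Proof. exact: continuous_borel_measurable. Qed.

Let F j (x : {fset S}) : R := poisson_density (p j) (L j) (f j) x.
Let G (x : {fset S}) : R := \sum_(j < n) F j x.

Let F0 j x : 0 <= F j x.
Proof. by apply: poisson_density_ge0 => //; exact: ltW. Qed.

Let G0 x : 0 <= G x.
Proof. by apply: sumr_ge0. Qed.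

Let mF j : measurable_fun [set: config S] (F j : config S -> R).
Proof. exact: measurable_poisson_density. Qed.

Let mG : measurable_fun [set: config S] (G : config S -> R).
Proof. by apply: measurable_sum. Qed.

Let mGV : measurable_fun [set: config S] (fun x : config S => (G x)^-1).
Proof. exact: measurable_funV_ge0. Qed.

(** Bayes' formula: [F j x / G x] is the conditional probability of class [j]. Where [G] vanishes
    the value is 0. *)
Definition posterior_mean (x : {fset S}) : R :=
  (\sum_(j < n) j%:R * F j x) / G x.

Let FG j x : (j < n)%N -> F j x <= G x.
Proof.
move=> jn; rewrite /G (bigD1 (Ordinal jn))//= lerDl; exact: sumr_ge0.
Qed.

(** The density vanishes exactly when some point of [x] is a zero of [f j]. The zero set of [f j]
    has [L j] mass 0, so almost no configuration has a point there. *)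
Let Q_density_null j : Q j [set x | F j x = 0] = 0%E.
Proof.
pose Z : set (borel S) := [set z | f j z = 0].
have mZ : measurable Z.
  by rewrite -[Z]setTI; exact: (@mf j measurableT [set 0]).
have LZ : L j Z = 0%E.
  have := @L_intensity j (cst 1%E) _ _ _ mZ.
  rewrite integral_cst// mul1e => -> //.
  by apply: integral0_eq => z Zz; rewrite mul1e Zz.
have := @Q_poisson j 1 (fun=> Z) (fun=> [set k | (0 < k)%N]) _ _.
rewrite big_ord1 LZ poisson_prob_gt0// oppr0 expR0 subrr mule0 => H.
rewrite -[RHS]H//; last by move=> [|i] [|k].
congr (Q j _); apply/seteqP; split => x /=.
  move=> /eqP; rewrite /F /poisson_density !mulf_eq0 (gt_eqF (p_gt0 j)) gt_eqF ?expR_gt0//=.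
  rewrite /config_prod prodf_seq_eq0 => /hasP[z zx /= /eqP fz] _ _.
  by apply/npoints_gt0P; exists z.
move=> /(_ 0%N isT)/npoints_gt0P[z zx Zz].
by rewrite /F /poisson_density /config_prod (big_rem z)//= Zz mul0r mulr0.
Qed.

Let mG0 : measurable ([set x | G x = 0] : set (config S)).
Proof. by rewrite -[X in measurable X]setTI; exact: (@mG measurableT [set 0]). Qed.

Let Q_G_null j : (j < n)%N -> Q j [set x | G x = 0] = 0%E.
Proof.
move=> jn; apply/eqP; rewrite eq_le measure_ge0 andbT -(Q_density_null j).
apply: le_measure; rewrite ?inE//.
  by rewrite -[X in measurable X]setTI; exact: (@mF j measurableT [set 0]).
move=> x /= Gx; apply/eqP; rewrite eq_le F0 andbT -Gx; exact: FG.
Qed.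

Lemma mixture_density_gt0 : {ae mu, forall x, 0 < G x}.
Proof.
exists [set x | G x = 0]; split=> //.
  by rewrite mu_mixture// big1// => j _; exact: Q_G_null.
by move=> x /= /negP; rewrite lt_neqAle G0 andbT negbK => /eqP.
Qed.

Let integral_mixture (g : config S -> \bar R) (D : set (config S)) :
  measurable D -> measurable_fun D g -> (forall x, D x -> 0 <= g x)%E ->
  (\int[mu]_(x in D) g x = \sum_(j < n) \int[Q j]_(x in D) g x)%E.
Proof.
move=> mD mg g0; rewrite -ge0_integral_measure_sum//.
by apply: eq_measure_integral => A mA _; exact: mu_mixture.
Qed.

(** In the sum over [k] of integrals against [Q k], [poisson_density_sym] trades [F j] under [Q k]
    for [F k] under [Q j]; the integrands then add up to [G / G]. *)
Lemma integral_posterior j A : (j < n)%N -> measurable A ->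
  (\int[mu]_(x in A) (F j x / G x)%:E = Q j A)%E.
Proof.
move=> jn mA.
have mq k D : measurable_fun D (fun x : config S => (F k x / G x)%:E).
  by apply: measurable_funTS; apply/measurable_EFinP; exact: measurable_funM.
have q0 k x : 0 <= F k x / G x by rewrite divr_ge0.
rewrite integral_mixture//; last by move=> x _; rewrite lee_fin.
transitivity (\sum_(k < n) \int[Q j]_(x in A) (F k x / G x)%:E)%E.
  apply: eq_bigr => k _.
  transitivity (\int[Q k]_(x in A) ((G x)^-1%:E * (F j x)%:E))%E.
    by apply: eq_integral => x _; rewrite -EFinM mulrC.
  transitivity (\int[Q j]_(x in A) ((G x)^-1%:E * (F k x)%:E))%E; last first.
    by apply: eq_integral => x _; rewrite -EFinM mulrC.
  apply: (poisson_density_sym (c := c) S_separable (ltW (p_gt0 k)) (ltW (p_gt0 j))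
    (Q_poisson k) (Q_poisson j) (L_fin k) (L_fin j) (L_intensity k) (L_intensity j)) => //.
    exact/measurable_EFinP.
  by move=> x; rewrite lee_fin invr_ge0.
rewrite -ge0_integral_sum//; last by move=> k x _; rewrite lee_fin.
rewrite -[RHS]mul1e -integral_cst//; apply: ae_eq_integral => //.
  by apply: emeasurable_sum.
(* The quotient [G / G] is 1 off the zeros of [G], which are null for [Q j]. *)
exists [set x | G x = 0]; split=> //; first exact: Q_G_null.
move=> x /= H; apply: contrapT => Gx; apply: H => _.
by rewrite sumEFin -mulr_suml divff//; exact/eqP.
Qed.

Lemma measurable_posterior_mean :
  measurable_fun [set: config S] (posterior_mean : config S -> R).
Proof.
apply: measurable_funM => //; apply: measurable_sum => j.
exact: measurable_funM.
Qed.

Lemma integral_posterior_mean A : measurable A ->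
  (\int[mu]_(x in A) (posterior_mean x)%:E = \sum_(j < n) j%:R%:E * Q j A)%E.
Proof.
move=> mA.
transitivity (\int[mu]_(x in A) \sum_(j < n) (j%:R%:E * (F j x / G x)%:E))%E.
  apply: eq_integral => x _; rewrite /posterior_mean mulr_suml -sumEFin.
  by apply: eq_bigr => j _; rewrite -EFinM [in RHS]mulrA.
have mq k D : measurable_fun D (fun x : config S => (F k x / G x)%:E).
  by apply: measurable_funTS; apply/measurable_EFinP; exact: measurable_funM.
have q0 k x : 0 <= F k x / G x by rewrite divr_ge0.
rewrite ge0_integral_sum//; last 2 first.
- by move=> j; apply: emeasurable_funM.
- by move=> j x _; rewrite mule_ge0// lee_fin.
apply: eq_bigr => j _; rewrite ge0_integralZl ?lee_fin//.
  by rewrite integral_posterior.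
by move=> x _; rewrite lee_fin.
Qed.

Lemma posterior_mean_itv x : 0 <= posterior_mean x <= n%:R.
Proof.
rewrite divr_ge0//=; last by apply: sumr_ge0 => j _; rewrite mulr_ge0.
have [G00|/eqP G00] := pselect (G x = 0); first by rewrite /posterior_mean G00 invr0 mulr0.
rewrite ler_pdivrMr; last by rewrite lt_neqAle eq_sym G00 G0.
rewrite mulr_sumr; apply: ler_sum => j _; rewrite ler_wpM2r// ler_nat.
exact: ltnW.
Qed.

Lemma cvg_posterior_mean x : 0 < G x ->
  posterior_mean y @[y --> perturbation_filter x] --> posterior_mean x.
Proof.
move=> Gx; have PF := perturbation_filter_filter x.
have cF j : F j y @[y --> perturbation_filter x] --> F j x.
  by apply: cvgMr; exact: cvg_config_prod.
apply: cvgM.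
  apply: cvg_big => [|j _]; first exact: add_continuous.
  exact: cvgMr.
apply: cvgV; first by rewrite gt_eqF.
by apply: cvg_big => [|j _]; [exact: add_continuous|exact: cF].
Qed.

Hypothesis L_atomless : forall j z, L j [set z] = 0%E.

(** Members of [one_each] are small perturbations of [x], along which the posterior mean converges;
    the rest of the ball has relative mass at most [s r], which tends to 0 by atomlessness. *)
Lemma cvg_ball_deviation_posterior_mean x : 0 < G x ->
  ball_deviation mu (hausdorff_dist : config S -> config S -> \bar R)
    posterior_mean x r @[r --> 0^'+] --> 0.
Proof.
(* Summing over all classes gives a single factor valid for every [Q j], hence for their sum
   [mu]. *)
move=> Gx; pose s r := \sum_(j < n) \sum_(i < #|` x|) fine (L j (cell x r i.+1)).
have s0 r : 0 <= s r.
  by apply: sumr_ge0 => j _; apply: sumr_ge0 => i _; exact: fine_ge0.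
have cs : s r @[r --> 0^'+] --> 0.
  rewrite [X in _ --> X](_ : _ = \sum_(j < n) 0); last by rewrite big1.
  apply: cvg_big => [|j _]; first exact: add_continuous.
  exact: cvg_measure_mcballs.
pose h (y : config S) : R := `|posterior_mean x - posterior_mean y|.
have mh : measurable_fun setT h.
  apply: measurableT_comp => //; apply: measurable_funB => //.
  exact: measurable_posterior_mean.
apply/cvgrPdist_le => e e0.
have PF := perturbation_filter_filter x.
have e20 : 0 < e / 2 by rewrite divr_gt0.
have [r1 r10 Hr1] : exists2 r1 : R, 0 < r1 &
    forall y, perturbation x r1 y -> h y <= e / 2.
  by move/cvgrPdist_le: (cvg_posterior_mean Gx) => /(_ _ e20)[r1 /= ? Hr1]; exists r1.
(* The posterior mean lies between 0 and [n], so [n + 1] bounds its deviations and is positive even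
   for [n = 0], which permits dividing by it. *)
have n0 : 0 < n%:R + 1 :> R by rewrite ltr_wpDl.
near=> r.
have r0 : 0 < r by near: r; exact: nbhs_right_gt.
have sep : spaced x r by near: r; exact: spaced_near.
have rr1 : r <= r1 by near: r; exact: nbhs_right_le.
have sr : (n%:R + 1) * s r <= e / 2.
  rewrite mulrC -ler_pdivlMr//.
  have : `|0 - s r| <= e / 2 / (n%:R + 1).
    near: r; move/cvgrPdist_le : cs; apply; by rewrite !divr_gt0.
  by rewrite sub0r normrN ger0_norm.
rewrite sub0r normrN ger0_norm; last first.
  apply: mulr_ge0; first by rewrite invr_ge0 fine_ge0.
  by apply: Rintegral_ge0 => y _.
apply: (@le_trans _ _ (e / 2 + (n%:R + 1) * s r)); last by lra.
have mB : measurable (dist_ball (U := config S) hausdorff_dist x r).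
  apply: measurable_dist_ball => // t t0.
  by apply: measurable_hausdorff_dist_le => //; exact: ltW.
apply: (@mean_deviation_le _ _ _ mu _ (one_each x r) h) => //.
- exact: measurable_one_each.
- exact: ltW.
- by move=> y; rewrite /h.
- move=> y _; rewrite /h.
  have /andP[a1 a2] := posterior_mean_itv x; have /andP[b1 b2] := posterior_mean_itv y.
  by rewrite ler_norml; apply/andP; split; lra.
- move=> y /(one_each_perturbation sep)[phi Hphi yphi]; apply: Hr1.
  by exists phi => // z /Hphi /le_trans; apply.
rewrite !mu_mixture//; last first.
  by apply: measurableD => //; exact: measurable_one_each.
rewrite ge0_sume_distrr//; apply: lee_sum => j _.
apply: le_trans (poisson_law_ball (ltW (p_gt0 j)) (Q_poisson j) (L_fin j) (ltW r0) sep) _.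
rewrite lee_wpmul2r// lee_fin /s (bigD1 j)//= lerDl.
by apply: sumr_ge0 => k _; apply: sumr_ge0 => i _; exact: fine_ge0.
Unshelve. all: by end_near. Qed.

(** Equal integrals over all measurable sets force [eta] to equal the posterior mean almost
    everywhere. For almost every centre, replacing one by the other leaves the ball averages
    unchanged. *)
Lemma besicovitch_posterior_mean (eta : config S -> R) :
  mu.-integrable [set: config S] (EFin \o eta) ->
  (forall A, measurable A ->
    (\int[mu]_(x in A) (eta x)%:E = \sum_(j < n) j%:R%:E * Q j A)%E) ->
  besicovitch mu hausdorff_dist eta.
Proof.
move=> ieta Heta.
have meta : measurable_fun [set: config S] eta.
  by apply/measurable_EFinP; exact: measurable_int ieta.
have mdist_le (r : R) : 0 < r -> measurable [set xy : config S * config S |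
    (hausdorff_dist xy.1 xy.2 <= r%:E)%E].
  by move=> r0; apply: measurable_hausdorff_dist_le => //; exact: ltW.
have eq_eta : ae_eq mu setT (EFin \o eta) (EFin \o posterior_mean).
  apply: integral_ae_eq => //.
    by apply/measurable_EFinP; exact: measurable_posterior_mean.
  by move=> A _ mA; rewrite Heta// integral_posterior_mean.
apply: besicovitch_ae => //.
have AF : Filter (almost_everywhere mu) by exact: ae_filter_ringOfSetsType.
apply: filterS2 mixture_density_gt0 (eq_eta) => x Gx /(_ I)[etax].
apply: cvg_trans (cvg_ball_deviation_posterior_mean Gx).
apply: near_eq_cvg; near=> r; rewrite /ball_deviation; congr (_ * fine _).
have r0 : 0 < r by near: r; exact: nbhs_right_gt.
have mB : measurable (dist_ball (U := config S) hausdorff_dist x r).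
  exact: measurable_dist_ball.
apply: ae_eq_integral => //.
- apply: measurable_funTS; apply/measurable_EFinP; apply: measurableT_comp => //.
  by apply: measurable_funB => //; exact: measurable_posterior_mean.
- apply: measurable_funTS; apply/measurable_EFinP; apply: measurableT_comp => //.
  exact: measurable_funB.
apply: filterS eq_eta => y /(_ I)[etay] _.
by rewrite etax etay.
Unshelve. all: by end_near. Qed.

End Mixture.

(** * Restricting the law of [X] to the events where [Y] is fixed *)

Section Conditioning.
Context {R : realType} {d d'} {T : measurableType d} {U : measurableType d'}.

Lemma restricted_law (P : probability T R) (X : {RV P >-> U}) (E : set T) :
  measurable E -> exists Q : {measure set U -> \bar R},
    forall A, Q A = P (X @^-1` A `&` E).
Proof.
move=> mE; pose q (A : set U) := P (X @^-1` A `&` E).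
have q0 : q set0 = 0%E by rewrite /q preimage_set0 set0I measure0.
have qge A : (0 <= q A)%E by exact: measure_ge0.
have mX A : measurable A -> measurable (X @^-1` A).
  by move=> mA; rewrite -[X in measurable X]setTI; exact: measurable_funP.
have qsig : semi_sigma_additive q.
  move=> F mF tF mUF; rewrite /q preimage_bigcup setI_bigcupl.
  apply: measure_semi_sigma_additive.
  - by move=> i; apply: measurableI => //; exact: mX.
  - apply/trivIsetP => i j _ _ ij.
    rewrite setIACA -preimage_setI.
    by move/trivIsetP : tF => /(_ _ _ I I ij) ->; rewrite preimage_set0 set0I.
  - by apply: bigcupT_measurable => i; apply: measurableI => //; exact: mX.
pose Q : {measure set U -> \bar R} := HB.pack q (isMeasure.Build d' U R q q0 qge qsig).
by exists Q.
Qed.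

Lemma cond_probE (P : probability T R) (E A : set T) : measurable E ->
  (0 < P E)%E -> P (A `&` E) = ((fine (P E))%:E * cond_prob P E A)%E.
Proof.
move=> mE PE0; have PE : P E \is a fin_num by exact: fin_num_measure.
rewrite /cond_prob muleC -muleA -EFinM mulVf ?mule1// gt_eqF//.
by rewrite fine_gt0// PE0 ltey_eq PE.
Qed.

End Conditioning.

Lemma finite_cover_measure d (T : measurableType d) (R : realType)
    (P : {measure set T -> \bar R}) (Y : T -> nat) (n : nat) (A : set T) :
  measurable_fun [set: T] Y -> (forall t, (Y t < n)%N) -> measurable A ->
  (P A = \sum_(j < n) P (A `&` Y @^-1` [set (j : nat)]))%E.
Proof.
move=> mY Yn mA.
have mAY j : measurable (A `&` Y @^-1` [set j]).
  by apply: measurableI => //; rewrite -[X in measurable X]setTI; exact: mY.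
have AE : A = \big[setU/set0]_(j < n) (A `&` Y @^-1` [set (j : nat)]).
  rewrite -(bigcup_mkord n (fun j => A `&` Y @^-1` [set j])).
  apply/seteqP; split => [t At|t [j _ []]//].
  by exists (Y t); [exact: Yn|].
rewrite [in LHS]AE (@measure_semi_additive_ord_I _ _ _ P
  (fun j => A `&` Y @^-1` [set j]))//.
  by move=> i j _ _ [t [[_ /= <-] [_ /= <-]]].
by rewrite -AE.
Qed.

Lemma measurable_borel_set1 (R : realType) (S : pmetricType R) (z : S) :
  measurable ([set z] : set (borel S)).
Proof.
rewrite (_ : [set z] = [set y | mdist z y <= 0]); first exact: measurable_mcball.
apply/seteqP; split => y /=; first by move=> ->; rewrite mdistxx.
by move=> zy; apply/esym/mdist_positivity/eqP; rewrite eq_le zy mdist_ge0.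
Qed.

(** * From conditional Poisson processes to the mixture of their laws *)

Theorem proposition2 (R : realType) (S : pmetricType R)
  (S_separable : separable S) (S_compact : compact [set: S])
  (nu : {measure set (borel S) -> \bar R})
  (nu_finite : (nu [set: borel S] < +oo)%E)
  (nu_atomless : forall z : S, nu [set z] = 0%E)
  (d : measure_display) (Omega : measurableType d) (P : probability Omega R)
  (X : {RV P >-> config S}) (M : nat) (Y : {RV P >-> nat})
  (Y_le : forall t : Omega, (Y t <= M)%N)
  (lambda : 'I_M.+1 -> S -> R)
  (lambda_ge0 : forall (j : 'I_M.+1) (z : S), 0 <= lambda j z)
  (lambda_cont : forall j : 'I_M.+1, continuous (lambda j))
  (Y_pos : forall j : 'I_M.+1, (0 < P (Y @^-1` [set (j : nat)]))%E)
  (X_poisson : forall j : 'I_M.+1,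
     poisson_process (cond_prob P (Y @^-1` [set (j : nat)])) nu (lambda j) X)
  (eta : config S -> R)
  (eta_regression : is_cond_expectation X (fun t => (Y t)%:R) eta) :
  besicovitch (distribution P X) hausdorff_dist eta.
Proof.
have mX A : measurable A -> measurable (X @^-1` A).
  by move=> mA; rewrite -[X in measurable X]setTI; exact: measurable_funP.
have mY : measurable_fun [set: Omega] Y by exact: measurable_funP.
have mE j : measurable (Y @^-1` [set j]).
  by rewrite -[X in measurable X]setTI; exact: mY.
have YM t : (Y t < M.+1)%N by rewrite ltnS.
(* Families are extended to all natural indices: [inord] sends those above [M] to class 0, and only
   indices up to [M] enter the sums. *)
pose f (j : nat) := lambda (inord j).
pose p (j : nat) := fine (P (Y @^-1` [set (inord j : 'I_M.+1) : nat])).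
have f0 j z : 0 <= f j z by exact: lambda_ge0.
have mf j : measurable_fun [set: borel S] (f j).
  by apply: continuous_borel_measurable; exact: lambda_cont.
have p0 j : 0 < p j.
  have Pfin := @fin_num_measure _ _ _ P _ (mE (inord j : 'I_M.+1)).
  by rewrite fine_gt0// Y_pos ltey_eq Pfin.
have /choice[b Hb] : forall j : 'I_M.+1, exists b, forall z, lambda j z <= b.
  by move=> j; exact: compact_continuous_bounded.
(* One bound for all intensities, each of which is bounded by compactness. *)
pose c := \sum_(j < M.+1) `|b j|.
have fc j z : 0 <= f j z <= c.
  rewrite f0/= (le_trans (Hb _ z))// (le_trans (ler_norm _))//.
  by rewrite /c (bigD1 (inord j))//= lerDl sumr_ge0.
have /choice[L HL] : forall j, exists L : {measure set (borel S) -> \bar R},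
    (forall A, measurable A -> L A = \int[nu]_(z in A) (f j z)%:E)%E /\
    intensity_measure nu L (f j).
  by move=> j; exact: (density_measure nu (mf j) (f0 j)).
have LE j A : measurable A -> (L j A = \int[nu]_(z in A) (f j z)%:E)%E.
  by case: (HL j) => + _; exact.
have Loo j : (L j setT < +oo)%E.
  have [ilam _ _] := X_poisson (inord j).
  by rewrite LE// -ge0_fin_numE ?integral_ge0//; first exact: integrable_fin_num ilam;
    move=> z _; rewrite lee_fin; exact: f0.
have Latom j z : L j [set z] = 0%E.
  have mz := measurable_borel_set1 z.
  rewrite LE// null_set_integral// ?nu_atomless//.
  by apply/measurable_EFinP; exact: measurable_funTS.
have /choice[Q HQ] : forall j, exists Q : {measure set (config S) -> \bar R},
    forall A, Q A = P (X @^-1` A `&` Y @^-1` [set (inord j : 'I_M.+1) : nat]).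
  by move=> j; exact: restricted_law.
(* [Q j] is [p j] times the conditional law, so independence and the Poisson marginals give the
   product formula. *)
have Q_poisson j : poisson_law (Q j) (p j) (L j).
  move=> n A K mA tA; have [_ indep law] := X_poisson (inord j).
  rewrite HQ cond_probE//; congr (_ * _)%E.
  have tA' : trivIset [set: 'I_n] (fun i : 'I_n => A i).
    move=> i k _ _ ik; apply: val_inj.
    exact: (tA _ _ (ltn_ord i) (ltn_ord k) ik).
  have mA' (i : 'I_n) : measurable (A i) by [].
  have := indep n (fun i : 'I_n => A i) mA' tA' (fun i : 'I_n => K i) (fun=> I).
  rewrite (_ : \bigcap_i _ = X @^-1` [set x | forall i, (i < n)%N ->
      K i (npoints (A i) x)]); last first.
    apply/seteqP; split => t /= H i; last by move=> _; exact: H.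
    by move=> ilt; exact: H (Ordinal ilt) I.
  by move=> ->; apply: eq_bigr => i _; rewrite law// /Rintegral LE.
have QE (j : 'I_M.+1) A : Q j A = P (X @^-1` A `&` Y @^-1` [set (j : nat)]).
  by rewrite HQ inord_val.
apply: (besicovitch_posterior_mean (n := M.+1) (c := c) S_separable p0 Q_poisson Loo
  (fun j => (HL j).2) fc _ _ Latom) => //.
- by move=> j; exact: lambda_cont.
- move=> A mA; under eq_bigr do rewrite QE.
  by exact: (finite_cover_measure P mY YM (mX A mA)).
- by case: eta_regression.
move=> A mA; under eq_bigr do rewrite QE.
have [_ ->//] := eta_regression.
have mXA := mX A mA.
(* Writing [Y] as the sum of [j] times the indicator of [Y = j] turns the regression identity into
   the sum of the [j * Q j A]. *)
transitivity (\int[P]_(t in X @^-1` A)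
    (\sum_(j < M.+1) (j%:R * \1_(Y @^-1` [set (j : nat)]) t)%:E))%E.
  apply: eq_integral => t _; rewrite sumEFin; congr (_%:E).

  rewrite (bigD1 (Ordinal (YM t)))//= big1 => [|j jY].
    by rewrite indicE mem_set// mulr1 addr0.
  rewrite indicE memNset ?mulr0// => /= Yj.
  by move/eqP: jY; apply; apply: val_inj.
rewrite ge0_integral_sum//; last first.
  move=> j; apply/measurable_EFinP; apply: measurable_funM => //.
apply: eq_bigr => j _; under eq_integral do rewrite EFinM.
rewrite ge0_integralZl//; last by apply/measurable_EFinP; exact: measurable_indic.
by rewrite integral_indic// setIC.
Qed.
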